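(* Assume the setting and standing conditions listed in the context. (a) Suppose $q=o(n)$. If the smoothing parameter is chosen as $\lambda=(q/n)^{4/3}$ when $q\ge n^{0.4}$ and $\lambda=n^{-0.8}$ when $q<n^{0.4}$, then $R_2(f,\hat f^{\,a}_{\mathrm{SS}})\to 0$ as $n\to\infty$. Similarly, if the smoothing parameter is chosen as $\lambda=(q/n)^{6/5}$ when $q\ge n^{0.5}$ and $\lambda=n^{-0.8}$ when $q<n^{0.5}$, then $R_\infty(f,\hat f^{\,a}_{\mathrm{SS}})\to 0$ as $n\to\infty$. Consequently, as long as $q=o(n)$, $R_2(f,\hat f^{\,a}_{\mathrm{SS}})$ and $R_\infty(f,\hat f^{\,a}_{\mathrm{SS}})$ go to zero as $n\to\infty$ (with these respective choices of $\lambda$). (b) Conversely, if $q=\Theta(n)$, there exists a function $f\in\mathcal W^2(\Omega)$ such that, for any estimator $\hat f$, none of $R_2(f,\hat f)$ and $R_\infty(f,\hat f)$ converges to zero as $n\to\infty$. (c) This implies that the classical cubic smoothing spline estimator $\hat f^{\,a}_{\mathrm{SS}}$ is optimal with respect to the maximum tolerable number of adversarial corruptions.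
   Context: Setting. $\Omega=[0,1]$; $\mathcal W^2(\Omega)$ is the second-order Sobolev space of square-integrable functions on $\Omega$ whose first and second derivatives are square-integrable on $\Omega$. The regression function $f\in\mathcal W^2(\Omega)$ is bounded, $|f(x)|\le m_1$ for all $x\in\Omega$. There are $n$ fixed design points $x_1,\dots,x_n\in\Omega$ and a known integer $q<n$. Data. For an unknown set $\mathcal A\subseteq\{1,\dots,n\}$ with $|\mathcal A|\le q$, the observed responses are $\widetilde y_i=f(x_i)+\varepsilon_i$ for $i\notin\mathcal A$, where the $\varepsilon_i$ are i.i.d. noise variables with mean zero and variance at most $\sigma^2$; for $i\in\mathcal A$ the value $\widetilde y_i$ is chosen strategically by an adversary, with $|\widetilde y_i|\le m_2$. An adversarial strategy $\mathcal S$ consists of the choice of $\mathcal A$ with $|\mathcal A|\le q$ and of the values $\widetilde y_i$, $i\in\mathcal A$. Error metrics. For an estimator $\hat f$ of $f$ based on $\{(x_i,\widetilde y_i)\}_{i=1}^n$, with $\varepsilon$ denoting the noise vector, $$R_2(f,\hat f)=\mathbb E_{\varepsilon}\Big[\sup_{\mathcal S}\|f-\hat f\|_{L_2(\Omega)}^2\Big],\qquad R_\infty(f,\hat f)=\mathbb E_{\varepsilon}\Big[\sup_{\mathcal S}\|f-\hat f\|_{L_\infty(\Omega)}^2\Big].$$ Estimator. The cubic smoothing spline estimator is $$\hat f^{\,a}_{\mathrm{SS}}=\arg\min_{g\in\mathcal W^2(\Omega)}\Big\{\frac1n\sum_{i=1}^n (g(x_i)-\widetilde y_i)^2+\lambda\int_\Omega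 (g''(x))^2\,dx\Big\},$$ with smoothing parameter $\lambda>0$ such that $\lambda\to0$ as $n\to\infty$ and $\lambda>n^{-2}$. Design assumptions. (i) The empirical distribution functions $F_n(x)=\frac1n\sum_{i=1}^n\mathbf 1\{x_i\le x\}$ converge uniformly on $\Omega$ to a continuously differentiable cumulative distribution function $F$, whose density $p=F'$ is three times continuously differentiable on $\Omega$ and satisfies $\inf_{x\in\Omega}p(x)\ge p_{\min}$ for some constant $p_{\min}>0$. (ii) With $\Delta_{\max}=\sup_{x\in\Omega}\min_{i}|x-x_i|$ and $\Delta_{\min}=\min_{i\ne j}|x_i-x_j|$, there is a constant $k>0$ with $\Delta_{\max}/\Delta_{\min}\le k$.
   Formalization: In (b) the quantifiers are swapped: for any estimator there is an f in W^2 with |f| ≤ m_1 for which neither R_2 nor R_∞ converges to zero; in the literal order the claim is false, since the estimator that always returns f has zero risk. *)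

(* Defs.v *)
(* MathComp / MathComp-Analysis. *)
From HB Require Import structures.
From mathcomp Require Import all_boot all_order all_algebra.
From mathcomp Require Import all_classical all_reals all_analysis.
From mathcomp Require Import measurable_realfun ess_sup_inf.

Set Implicit Arguments.
Unset Strict Implicit.
Unset Printing Implicit Defensive.
Import Order.TTheory GRing.Theory Num.Theory.
Import numFieldNormedType.Exports.

Local Open Scope classical_set_scope.
Local Open Scope ring_scope.

Section FunctionSpaces.
Variable R : realType.
Implicit Types (f g h : R -> R).

(* Functions on Omega are represented by total functions R -> R; only their
   values on Omega are ever used. *)
Definition Omega : set R := `[0, 1]%classic.

Notation mu := (@lebesgue_measure R).

Definition square_integrable h : Prop :=
  measurable_fun Omega h /\ mu.-integrable Omega (fun x => (h x ^+ 2)%:E).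

(* [g] is absolutely continuous on Omega with square-integrable derivative
   [g'].  Requiring the identity at every point (not almost everywhere) selects
   the continuous representative of a Sobolev class, so that the evaluations
   g(x_i) are meaningful. *)
Definition has_L2_deriv g g' : Prop :=
  square_integrable g' /\
  forall x, Omega x -> g x = g 0 + \int[mu]_(t in `[0, x]) g' t.

Definition W2_derivs g g1 g2 : Prop :=
  [/\ square_integrable g, has_L2_deriv g g1 & has_L2_deriv g1 g2].

Definition W2 : set (R -> R) := [set g | exists g1 g2, W2_derivs g g1 g2].

(* A chosen version of the second derivative of [g]; it is determined up to a
   null set when [g] is in W2. *)
Definition second_deriv g : R -> R :=
  xget (cst 0) [set g2 | exists g1, W2_derivs g g1 g2].

Fixpoint Ck (k : nat) f : Prop :=
  {within Omega, continuous f} /\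
  match k with
  | 0%N => True
  | k'.+1 => exists f', (forall x : R, 0 < x < 1 -> is_derive x (1 : R) f (f' x))
                        /\ Ck k' f'
  end.

(* The squared L_p(Omega) norm of f - g, through extension by zero. *)
Definition sq_loss (p : \bar R) f g : \bar R :=
  ('N[mu]_p[EFin \o ((f \- g)%R \_ Omega)] ^+ 2)%E.

End FunctionSpaces.
Arguments Omega R : clear implicits.

Section SmoothingSpline.
Variable R : realType.

Definition spline_objective (lam : R) (n : nat) (x y : 'I_n -> R) (g : R -> R)
    : R :=
  n%:R^-1 * \sum_(i < n) (g (x i) - y i) ^+ 2
  + lam * \int[@lebesgue_measure R]_(t in Omega R) (second_deriv g t) ^+ 2.

Definition is_smoothing_spline (lam : R) (n : nat) (x y : 'I_n -> R)
    (g : R -> R) : Prop :=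
  W2 g /\ forall h, W2 h -> spline_objective lam x y g <= spline_objective lam x y h.

Definition smoothing_spline (lam : R) (n : nat) (x y : 'I_n -> R) : R -> R :=
  xget (cst 0) [set g | is_smoothing_spline lam x y g].

(* One data-to-function map for each sample size: design points, then observed
   responses. *)
Definition estimator : Type := forall n, ('I_n -> R) -> ('I_n -> R) -> R -> R.

Definition measurable_estimator (est : estimator) : Prop :=
  forall n (x y : 'I_n -> R), measurable_fun (Omega R) (est n x y).

Definition spline_estimator (lam : nat -> R) : estimator :=
  fun n x y => smoothing_spline (lam n) x y.

Definition lambda_L2 (q : nat -> nat) (n : nat) : R :=
  if n%:R `^ (2 / 5) <= (q n)%:R :> R then ((q n)%:R / n%:R) `^ (4 / 3)
  else n%:R `^ (- (4 / 5)).

Definition lambda_Linf (q : nat -> nat) (n : nat) : R :=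
  if n%:R `^ (1 / 2) <= (q n)%:R :> R then ((q n)%:R / n%:R) `^ (6 / 5)
  else n%:R `^ (- (4 / 5)).

End SmoothingSpline.

Section Design.
Variable R : realType.

Definition empirical_cdf (n : nat) (x : 'I_n -> R) (t : R) : R :=
  n%:R^-1 * \sum_(i < n) (x i <= t)%R%:R.

Definition regular_design (x : forall n, 'I_n -> R) : Prop :=
  exists (F p : R -> R) (pmin : R),
    [/\ {uniform Omega R, (fun n => empirical_cdf (x n)) @ \oo --> F},
        F 0 = 0 /\ F 1 = 1,
        {within Omega R, continuous F} /\
          (forall t : R, 0 < t < 1 -> is_derive t (1 : R) F (p t)),
        Ck 3 p
      & 0 < pmin /\ (forall t, Omega R t -> pmin <= p t)].

(* The infimum below is over a finite set, hence a minimum when [0 < n]. *)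
Definition Delta_max (n : nat) (x : 'I_n -> R) : R :=
  sup [set inf [set `|t - x i| | i in [set: 'I_n]] | t in Omega R].

(* A minimum when [2 <= n]. *)
Definition Delta_min (n : nat) (x : 'I_n -> R) : R :=
  inf [set `|x ij.1 - x ij.2| | ij in [set ij : 'I_n * 'I_n | ij.1 != ij.2]].

Definition quasi_uniform_design (x : forall n, 'I_n -> R) : Prop :=
  exists k : R, 0 < k /\ forall n, (2 <= n)%N ->
    0 < Delta_min (x n) /\ Delta_max (x n) / Delta_min (x n) <= k.

End Design.

Section Noise.
Context (R : realType) (d : measure_display) (T : measurableType d).
Variable P : probability T R.

Definition mutually_independent (n : nat) (X : 'I_n -> {RV P >-> R}) : Prop :=
  forall (J : {set 'I_n}) (B : 'I_n -> set R), (forall i, measurable (B i)) ->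
    P (\bigcap_(i in [set` J]) (X i @^-1` B i)) =
    (\prod_(i in J) P (X i @^-1` B i))%E.

Definition identically_distributed (n : nat) (X : 'I_n -> {RV P >-> R}) : Prop :=
  forall (i j : 'I_n) (B : set R), measurable B ->
    distribution P (X i) B = distribution P (X j) B.

Definition iid_noise (sigma : R) (n : nat) (eps : 'I_n -> {RV P >-> R}) : Prop :=
  [/\ mutually_independent eps, identically_distributed eps,
      (forall i, 'E_P[eps i] = 0)%E
    & (forall i, 'V_P[eps i] <= (sigma ^+ 2)%:E)%E].

(* Upper expectation of a nonnegative function: it is the expectation when the
   function is measurable ([upper_expectationE] below), and it is meaningful
   without discussing the measurability of the supremum over all adversarial
   strategies. *)
Definition upper_expectation (h : T -> \bar R) : \bar R :=
  ereal_inf [set (\int[P]_w g w)%E | g in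
    [set g : T -> \bar R | measurable_fun setT g /\ forall w, (h w <= g w)%E]].

Lemma upper_expectationE (h : T -> \bar R) :
  (forall w, (0 <= h w)%E) -> measurable_fun setT h ->
  upper_expectation h = (\int[P]_w h w)%E.
Proof.
move=> h0 mh; apply/eqP; rewrite eq_le; apply/andP; split.
  by apply: ereal_inf_lbound; exists h.
apply: le_ereal_inf_tmp => _ [g [mg hg] <-].
by apply: ge0_le_integral => // w _; apply: le_trans (hg w).
Qed.

End Noise.

Section Risk.
Context (R : realType) (d : measure_display) (T : measurableType d).
Variable P : probability T R.

(* A strategy is the corrupted set together with the values used on it. *)
Definition strategies (n q : nat) (m2 : R)
    : set ({set 'I_n} * ('I_n -> R)) :=
  [set S : {set 'I_n} * ('I_n -> R) |
    (#|S.1| <= q)%N /\ forall i : 'I_n, i \in S.1 -> `|S.2 i| <= m2].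

Definition observed (f : R -> R) (n : nat) (x e : 'I_n -> R)
    (S : {set 'I_n} * ('I_n -> R)) : 'I_n -> R :=
  fun i => if i \in S.1 then S.2 i else f (x i) + e i.

Definition worst_loss (p : \bar R) (q : nat) (m2 : R) (f : R -> R)
    (est : estimator R) (n : nat) (x e : 'I_n -> R) : \bar R :=
  ereal_sup [set sq_loss p f (est n x (observed f x e S))
            | S in strategies q m2].

(* [p = 2] gives R_2 and [p = +oo] gives R_oo, as functions of the sample
   size. *)
Definition risk (p : \bar R) (eps : forall n, 'I_n -> {RV P >-> R})
    (x : forall n, 'I_n -> R) (m2 : R) (q : nat -> nat) (f : R -> R)
    (est : estimator R) (n : nat) : \bar R :=
  upper_expectation P
    (fun w => worst_loss p (q n) m2 f est (x n) (fun i => eps n i w)).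

Definition admissible (m1 : R) (f : R -> R) : Prop :=
  W2 f /\ forall t, Omega R t -> `|f t| <= m1.

Definition corruption_budget (q : nat -> nat) : Prop :=
  forall n, (0 < n)%N -> (q n < n)%N.

Definition tolerates (p : \bar R) (eps : forall n, 'I_n -> {RV P >-> R})
    (x : forall n, 'I_n -> R) (m1 m2 : R) (q : nat -> nat) (est : estimator R)
    : Prop :=
  measurable_estimator est /\
  forall f, admissible m1 f -> risk p eps x m2 q f est n @[n --> \oo] --> 0%E.

(* Any growth of the number of corruptions that is tolerated by some estimator
   is tolerated by [proc] (tuned to it, the budget being known). *)
Definition optimal_tolerance (p : \bar R)
    (eps : forall n, 'I_n -> {RV P >-> R}) (x : forall n, 'I_n -> R)
    (m1 m2 : R) (proc : (nat -> nat) -> estimator R) : Prop :=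
  forall q, corruption_budget q ->
    (exists est, tolerates p eps x m1 m2 q est) ->
    tolerates p eps x m1 m2 q (proc q).

End Risk.

(* Main.v *)
(* Let E(v) = 1/n sum_i v(x_i)^2 + lambda int v''^2.  Quasi-uniformity puts order
   n h design points in every interval of length h = lambda^(1/4), and first-order
   Taylor expansion then gives |v|^2 <= C E(v) / h on [0, 1].  Comparing the spline
   with f, the error v satisfies E(v) <= 4/n sum_i w_i v(x_i) + 4 lambda int f''^2,
   where w is the noise plus the corruption.  The corruption touches at most q
   points, so Cauchy-Schwarz and the sup bound control its share by q / (n h).  For
   the noise, v(x_i) is the energy product of v with a representer u_i, and the
   energy of sum_i e_i u_i is a quadratic form whose expectation is at most
   sigma^2 max_i u_i(x_i) <= C sigma^2 / (n h).  The squared sup-norm risk is hence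
   O(q / (n h^2) + 1 / (n h^2) + h^3), which tends to 0 for both choices of lambda
   and dominates both risks.

   When q >= c n infinitely often, pick b with F(b) < c / 2 and a bump supported in
   [0, b): reporting 0 at all design points of [0, b] makes the bump and the zero
   function indistinguishable.  This gives (b), and (c) because failure of
   q = o(n) means that q >= c n infinitely often for some c > 0. *)

Require Import Defs.
From HB Require Import structures.
From mathcomp Require Import all_boot all_order all_algebra.
From mathcomp Require Import all_classical all_reals all_analysis.
From mathcomp Require Import measurable_realfun ess_sup_inf.
Import Order.TTheory GRing.Theory Num.Theory.
Import numFieldNormedType.Exports.
From mathcomp Require Import ring lra.
Local Open Scope classical_set_scope.
Local Open Scope ring_scope.
Set Implicit Arguments.
Unset Strict Implicit.
Unset Printing Implicit Defensive.

(** * Square-integrable functions and Sobolev functions on [0, 1] *)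

(** The choice h = lambda^(1/4) makes the two parts of the sup bound scale alike: on a window of
    length h the values cost 1/h times their empirical mean square, and the curvature costs h^3 =
    lambda / h. The corruption may depend on the noise, so the loss is bounded pathwise by a
    quantity free of the strategy; this majorant is also the measurable function that the upper
    expectation calls for. Treating the noise like the corruption, with n in place of q, would leave
    a term of order sigma^2 / h^2; independence has to enter, and it does so through the
    representers. [smoothing_spline] and [second_deriv] are choices with a default value: the first
    is meaningful only once a minimizer exists, and the second is handled through inner products,
    which do not depend on the version. In (b) the function depends on the estimator, as it must: an
    estimator that always returns f has no loss at f. It is the bump or the zero function, whichever
    defeats the estimator. *)

Section SquareIntegrable.
Variable R : realType.
Implicit Types (f g h : R -> R) (a b c t : R).
Notation mu := (@lebesgue_measure R).
Notation Om := (Omega R).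

Lemma measurable_Omega : measurable Om.
Proof. exact: measurable_itv. Qed.
Hint Resolve measurable_Omega : core.

Lemma measure_Omega : mu Om = 1%:E.
Proof. by rewrite /Omega lebesgue_measure_itv/= lte_fin ltr01 -EFinB subr0. Qed.

Lemma OmegaE t : Om t = (0 <= t <= 1) :> Prop.
Proof. by rewrite /Omega/= in_itv/=. Qed.

Definition integrable_on_Omega f := mu.-integrable Om (EFin \o f).

Lemma integrable_OmegaP f : integrable_on_Omega f -> measurable_fun Om f.
Proof. by move/measurable_int/measurable_EFinP. Qed.

Lemma le_integrable_Omega f g : measurable_fun Om f -> integrable_on_Omega g ->
  (forall t, Om t -> `|f t| <= g t) -> integrable_on_Omega f.
Proof.
move=> mf ig fg; apply: le_integrable ig => //; first exact/measurable_EFinP.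
by move=> t Dt /=; rewrite lee_fin (le_trans (fg _ Dt))// ler_norm.
Qed.

Lemma integrable_Omega_cst c : integrable_on_Omega (cst c).
Proof.
apply: continuous_compact_integrable; first exact: segment_compact.
by apply: continuous_subspaceT => t; exact: cst_continuous.
Qed.

Lemma integrable_OmegaD f g : integrable_on_Omega f -> integrable_on_Omega g ->
  integrable_on_Omega (f \+ g).
Proof. by move=> hf hg; exact: (integrableD _ hf hg). Qed.

Lemma integrable_OmegaZ c f : integrable_on_Omega f ->
  integrable_on_Omega (fun t => c * f t).
Proof. by move=> hf; exact: (integrableZl _ _ hf). Qed.

Lemma sqintM f g : square_integrable f -> square_integrable g ->
  integrable_on_Omega (fun t => f t * g t).
Proof.
move=> [mf f2] [mg g2].
apply: (@le_integrable_Omega _ (fun t => f t ^+ 2 + g t ^+ 2)).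
- exact: measurable_funM.
- exact: integrable_OmegaD.
- move=> t _; rewrite ler_norml.
  have := sqr_ge0 (f t + g t); have := sqr_ge0 (f t - g t).
  have := sqr_ge0 (f t); have := sqr_ge0 (g t).
  by move=> ? ? ? ?; apply/andP; split; nra.
Qed.

Lemma sqint_cst c : square_integrable (cst c : R -> R).
Proof. by split=> //; exact: (integrable_Omega_cst (c ^+ 2)). Qed.

Lemma sqint_integrable f : square_integrable f -> integrable_on_Omega f.
Proof.
move=> sf; have := sqintM sf (sqint_cst 1); apply: eq_integrable => //.
by move=> t _ /=; rewrite mulr1.
Qed.

Lemma sqintZ c f : square_integrable f -> square_integrable (fun t => c * f t).
Proof.
move=> [mf f2]; split; first exact: measurable_funM.
apply: eq_integrable (integrable_OmegaZ (c ^+ 2) f2) => //.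
by move=> t _ /=; rewrite exprMn.
Qed.

Lemma sqintD f g : square_integrable f -> square_integrable g ->
  square_integrable (f \+ g).
Proof.
move=> sf sg; have [[mf f2] [mg g2]] := (sf, sg).
split; first exact: measurable_funD.
have := integrable_OmegaD (integrable_OmegaD f2 g2) (integrable_OmegaZ 2 (sqintM sf sg)).
apply: eq_integrable => // t _ /=; congr EFin; ring.
Qed.

Lemma eq_sqint f g : {in Om, f =1 g} -> square_integrable f -> square_integrable g.
Proof.
move=> fg [mf f2]; split; first exact: eq_measurable_fun mf.
by apply: eq_integrable f2 => // t Dt; rewrite /= fg.
Qed.

Lemma continuous_sqint f : {within Om, continuous f} -> square_integrable f.
Proof.
move=> cf; split; first exact: subspace_continuous_measurable_fun.
apply: continuous_compact_integrable; first exact: segment_compact.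
by move=> t; rewrite /=; apply: continuousM; exact: cf.
Qed.

(** The version picked by [second_deriv] is known only up to a null set, so it is handled through
    pairings with square-integrable functions. *)
Definition ip f g : R := \int[mu]_(t in Om) (f t * g t).

Lemma ipC f g : ip f g = ip g f.
Proof. by apply: eq_Rintegral => t _; rewrite mulrC. Qed.

Lemma ipDl f g h : square_integrable f -> square_integrable g ->
  square_integrable h -> ip (f \+ g) h = ip f h + ip g h.
Proof.
move=> sf sg sh; rewrite /ip -RintegralD//; [|exact: sqintM..].
by apply: eq_Rintegral => t _; rewrite mulrDl.
Qed.

Lemma ipZl c f h : square_integrable f -> square_integrable h ->
  ip (fun t => c * f t) h = c * ip f h.
Proof.
move=> sf sh; rewrite /ip -RintegralZl//; last exact: sqintM.
by apply: eq_Rintegral => t _; rewrite mulrA.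
Qed.

Lemma ip_ge0 f : 0 <= ip f f.
Proof. by apply: Rintegral_ge0 => t _; rewrite -expr2 sqr_ge0. Qed.

Lemma ip_comb a b f g : square_integrable f -> square_integrable g ->
  ip (fun t => a * f t + b * g t) (fun t => a * f t + b * g t) =
  a ^+ 2 * ip f f + 2 * a * b * ip f g + b ^+ 2 * ip g g.
Proof.
move=> sf sg.
have sa := sqintZ a sf; have sb := sqintZ b sg; have sab := sqintD sa sb.
rewrite ipDl// ![ip _ (fun t => _ + _)]ipC !ipDl// !ipZl//.
rewrite ![ip _ (fun t => _ * _)]ipC !ipZl// (ipC g f); ring.
Qed.

End SquareIntegrable.

(** The discriminant argument, kept free of any particular form because it serves both the integral
    inner product and the empirical sums over corrupted points. *)
Lemma quadratic_form_CS (R : realFieldType) (A B C : R) :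
  0 <= A -> (forall a b : R, 0 <= a ^+ 2 * A + 2 * a * b * B + b ^+ 2 * C) ->
  B ^+ 2 <= A * C.
Proof.
move=> A0 H; have [A00|An0] := eqVneq A 0.
  have C0 : 0 <= C by have := H 0 1; rewrite A00; nra.
  have [->|Bn0] := eqVneq B 0; first by rewrite A00; nra.
  (* With A = 0 the form at (a, 1) is 2 a B + C; this [a] makes it -1. *)
  have := H (- (C + 1) / (2 * B)) 1; rewrite A00.
  have -> : (- (C + 1) / (2 * B)) ^+ 2 * 0 + 2 * (- (C + 1) / (2 * B)) * 1 * B +
    1 ^+ 2 * C = -1 by field.
  lra.
have := H (- B) A.
have -> : (- B) ^+ 2 * A + 2 * - B * A * B + A ^+ 2 * C = A * (A * C - B ^+ 2) by ring.
by rewrite pmulr_rge0 ?subr_ge0// lt_def An0.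
Qed.

Lemma ip_CS (R : realType) (f g : R -> R) : square_integrable f ->
  square_integrable g -> ip f g ^+ 2 <= ip f f * ip g g.
Proof.
move=> sf sg; apply: quadratic_form_CS; first exact: ip_ge0.
by move=> a b; rewrite -ip_comb// ip_ge0.
Qed.

Section Sobolev.
Variable R : realType.
Implicit Types (f g h v w : R -> R) (a b c r s t x : R).
Notation mu := (@lebesgue_measure R).
Notation Om := (Omega R).

Definition L2norm f : R := Num.sqrt (ip f f).

Lemma L2norm_ge0 f : 0 <= L2norm f. Proof. exact: sqrtr_ge0. Qed.

Lemma sqr_L2norm f : L2norm f ^+ 2 = ip f f.
Proof. by rewrite sqr_sqrtr// ip_ge0. Qed.

Lemma integrable_sub_Omega (A : set R) f : measurable A -> A `<=` Om ->
  integrable_on_Omega f -> mu.-integrable A (EFin \o f).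
Proof. by move=> mA AO; apply: integrableS => //; exact: measurable_Omega. Qed.

Lemma itv_sub_Omega (b1 b2 : bool) s t : 0 <= s -> t <= 1 ->
  [set` Interval (BSide b1 s) (BSide b2 t)] `<=` Om.
Proof.
move=> s0 t1 u /=; rewrite in_itv/= => /andP[su ut]; rewrite OmegaE.
by rewrite (le_trans s0 (lteifW su)) (le_trans (lteifW ut) t1).
Qed.

Lemma deriv_increment g h s t : has_L2_deriv g h -> 0 <= s -> s <= t -> t <= 1 ->
  g t - g s = \int[mu]_(u in `]s, t]) h u.
Proof.
move=> [sh gE] s0 st t1.
rewrite (gE t) ?(gE s) ?OmegaE ?s0 ?t1 ?(le_trans s0) ?(le_trans st)//.
rewrite opprD addrACA subrr add0r Rintegral_itvB ?bnd_simp//.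
by apply: integrable_sub_Omega (sqint_integrable sh) => //; exact: itv_sub_Omega.
Qed.

Lemma sqint_indic (A : set R) : measurable A -> square_integrable (\1_A : R -> R).
Proof.
move=> mA; split; first exact: measurable_indic.
apply: (@le_integrable_Omega _ _ (cst 1)); last 2 first.
- exact: integrable_Omega_cst.
- by move=> t _; rewrite indicE; case: (_ \in _); rewrite /= ?expr1n ?expr0n/= ?normr1 ?normr0.
- exact/measurable_funX/measurable_indic.
Qed.

Lemma Rintegral_indic_ip (A : set R) h : A `<=` Om ->
  \int[mu]_(u in A) h u = ip \1_A h.
Proof.
move=> AO; rewrite -[in LHS](setIidr AO) Rintegral_mkcondr.
apply: eq_Rintegral => t _; rewrite patchE indicE.
by case: (_ \in _); rewrite ?mul1r ?mul0r.
Qed.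

Lemma ip_indic (A : set R) : measurable A -> A `<=` Om -> ip (\1_A) (\1_A) = fine (mu A).
Proof.
move=> mA AO; rewrite -Rintegral_indic_ip// -[RHS]mul1r -Rintegral_cst//.
by apply: eq_Rintegral => t tA; rewrite indicE tA.
Qed.

(** Cauchy-Schwarz between the derivative and the indicator of the interval from [s] to [t]. *)
Lemma deriv_holder_sqr g h s t : has_L2_deriv g h -> Om s -> Om t ->
  (g t - g s) ^+ 2 <= `|t - s| * ip h h.
Proof.
wlog st : s t / s <= t => [H gh Os Ot|].
  have [st|/ltW ts] := leP s t; first exact: H.
  by rewrite distrC -sqrrN opprB H.
move=> gh; rewrite !OmegaE => /andP[s0 s1] /andP[t0 t1].
rewrite (deriv_increment gh)// Rintegral_indic_ip; last exact: itv_sub_Omega.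
apply: le_trans (ip_CS (sqint_indic _) gh.1) _ => //.
rewrite ip_indic//; last exact: itv_sub_Omega.
rewrite lebesgue_measure_itv/= lte_fin ger0_norm ?subr_ge0//.
by case: ltP => // ts; rewrite /= ler_wpM2r ?ip_ge0// subr_ge0.
Qed.

Lemma deriv_holder g h s t : has_L2_deriv g h -> Om s -> Om t ->
  `|g t - g s| <= Num.sqrt `|t - s| * L2norm h.
Proof.
move=> gh Os Ot; rewrite -sqrtrM// -sqrtr_sqr ler_wsqrtr//.
exact: deriv_holder_sqr.
Qed.

Lemma itv_Omega a b t : 0 <= a -> b <= 1 -> a <= t <= b -> Om t.
Proof. by move=> a0 b1 /andP[? ?]; rewrite OmegaE; apply/andP; split; lra. Qed.

(** The slope may be taken at any point [r] of [a, b], since the square-root modulus of continuity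
    of [v1] bounds its oscillation over the whole interval. This freedom lets two increments share
    the slope at one point. *)
Lemma taylor1 v v1 v2 a b r s t : has_L2_deriv v v1 -> has_L2_deriv v1 v2 ->
  0 <= a -> b <= 1 -> a <= r <= b -> a <= s <= b -> a <= t <= b ->
  `|v t - v s - v1 r * (t - s)| <= `|t - s| * (Num.sqrt (b - a) * L2norm v2).
Proof.
move=> vv1 vv2 a0 b1 ar.
wlog st : s t / s <= t => [H as_ at_|].
  have [st|/ltW ts] := leP s t; first exact: H.
  have -> : v t - v s - v1 r * (t - s) = - (v s - v t - v1 r * (s - t)) by ring.
  by rewrite normrN [`|t - s|]distrC; exact: H.
move=> /andP[as_ sb] /andP[at_ tb].
have [Os Ot] : 0 <= s /\ t <= 1 by split; lra.
have sub : `]s, t] `<=` Om by exact: itv_sub_Omega.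
have iv1 : mu.-integrable `]s, t] (EFin \o v1).
  by apply: integrable_sub_Omega (sqint_integrable vv1.1).
have ic c : mu.-integrable `]s, t] (EFin \o cst c).
  by apply: integrable_sub_Omega (integrable_Omega_cst c).
have mst : fine (mu `]s, t]) = t - s.
  by rewrite lebesgue_measure_itv/= lte_fin; case: ltP => //= ts; lra.
have -> : v t - v s - v1 r * (t - s) = \int[mu]_(u in `]s, t]) (v1 u - v1 r).
  rewrite (RintegralB _ iv1 (ic _))// (deriv_increment vv1)//.
  by rewrite Rintegral_cst// mst.
have iB : mu.-integrable `]s, t] (EFin \o (fun u => v1 u - v1 r)).
  exact: (integrableB _ iv1 (ic _)).
apply: le_trans (le_normr_Rintegral _ iB) _ => //.
rewrite (ger0_norm (_ : 0 <= t - s)) ?subr_ge0// mulrC -mst -Rintegral_cst//.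
apply: le_Rintegral => //; first exact: integrable_norm iB.
- exact: ic.
- move=> u; rewrite /= in_itv/= => /andP[su ut].
  have au : a <= u <= b by apply/andP; split; lra.
  apply: le_trans (deriv_holder vv2 (itv_Omega a0 b1 ar) (itv_Omega a0 b1 au)) _.
  rewrite ler_wpM2r ?L2norm_ge0// ler_wsqrtr//.
  by move: ar au => /andP[? ?] /andP[? ?]; rewrite ler_norml; apply/andP; split; lra.
Qed.

(** Two values at least a third of the interval apart determine the slope at [x] up to the Taylor
    error; the value at [s] is then extrapolated to [x]. The factor 4 is 1 for [v s] plus 3 for the
    slope times the length. *)
Lemma sobolev_two_points v v1 v2 a b s t x :
  has_L2_deriv v v1 -> has_L2_deriv v1 v2 ->
  0 <= a -> a < b -> b <= 1 -> a <= s <= b -> a <= t <= b -> a <= x <= b ->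
  (b - a) / 3 <= `|t - s| ->
  `|v x| <= 4 * (`|v s| + `|v t|) + 2 * ((b - a) * (Num.sqrt (b - a) * L2norm v2)).
Proof.
move=> v01 v12 a0 ab b1 as_ at_ ax st.
set M := Num.sqrt _ * _; have M0 : 0 <= M by rewrite mulr_ge0 ?sqrtr_ge0.
have e1 := taylor1 v01 v12 a0 b1 ax as_ at_.
have e2 := taylor1 v01 v12 a0 b1 ax as_ ax.
rewrite -/M in e1 e2.
have h0 : 0 < b - a by rewrite subr_gt0.
have d0 : 0 < `|t - s| by apply: lt_le_trans st; rewrite divr_gt0.
have xs : `|x - s| <= b - a.
  by move: as_ ax => /andP[? ?] /andP[? ?]; rewrite ler_norml; apply/andP; split; lra.
have L1 : `|v1 x| * `|t - s| <= `|v s| + `|v t| + `|t - s| * M.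
  rewrite -normrM.
  have -> : v1 x * (t - s) = - v s + v t - (v t - v s - v1 x * (t - s)) by ring.
  apply: le_trans (ler_normB _ _) _; apply: lerD e1.
  by apply: le_trans (ler_normD _ _) _; rewrite normrN.
have L2 : `|v1 x| * (b - a) <= 3 * (`|v s| + `|v t|) + (b - a) * M.
  have q0 : 0 <= `|v1 x| by [].
  (* Replacing |t - s| by its lower bound (b - a) / 3 is legitimate only when the slope exceeds [M];
     otherwise the claim is immediate. *)
  have [Mv|vM] := leP (`|v1 x|) M.
    have : `|v1 x| * (b - a) <= M * (b - a) by rewrite ler_wpM2r// ltW.
    by have := normr_ge0 (v s); have := normr_ge0 (v t); lra.
  have : (`|v1 x| - M) * ((b - a) / 3) <= (`|v1 x| - M) * `|t - s|.
    by rewrite ler_wpM2l// subr_ge0 ltW.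
  lra.
have -> : v x = v s + v1 x * (x - s) + (v x - v s - v1 x * (x - s)) by ring.
apply: le_trans (ler_normD _ _) _.
have : `|v s + v1 x * (x - s)| <= `|v s| + `|v1 x| * (b - a).
  by apply: le_trans (ler_normD _ _) _; rewrite normrM lerD2l ler_wpM2l.
have : `|x - s| * M <= (b - a) * M by rewrite ler_wpM2r.
by have := normr_ge0 (v s); have := normr_ge0 (v t); lra.
Qed.

Lemma eq_W2_derivs f g f1 f2 : {in Om, f =1 g} -> W2_derivs f f1 f2 -> W2_derivs g f1 f2.
Proof.
move=> fg [sf [sf1 fE] f12]; split=> //; first exact: eq_sqint sf.
have O0 : (0 : R) \in Om by rewrite inE OmegaE lexx ler01.
by split=> // x Ox; rewrite -!fg// ?inE// fE.
Qed.

Lemma has_L2_deriv_comb a b f g f1 g1 : has_L2_deriv f f1 -> has_L2_deriv g g1 ->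
  has_L2_deriv (fun t => a * f t + b * g t) (fun t => a * f1 t + b * g1 t).
Proof.
move=> [sf fE] [sg gE]; split; first by apply: sqintD; exact: sqintZ.
move=> x Ox; have sub : `[0, x] `<=` Om.
  by move: Ox; rewrite OmegaE => /andP[_ ?]; exact: itv_sub_Omega.
have [If Ig] := (integrable_sub_Omega (measurable_itv _) sub (sqint_integrable sf),
  integrable_sub_Omega (measurable_itv _) sub (sqint_integrable sg)).
rewrite (RintegralD (mu := mu) (measurable_itv _) (f1 := fun t => a * f1 t)
  (f2 := fun t => b * g1 t)).
- by rewrite !RintegralZl// (fE x Ox) (gE x Ox); ring.
- exact: (integrableZl _ _ If).
- exact: (integrableZl _ _ Ig).
Qed.

Lemma W2_derivs_comb a b f g f1 g1 f2 g2 : W2_derivs f f1 f2 -> W2_derivs g g1 g2 ->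
  W2_derivs (fun t => a * f t + b * g t) (fun t => a * f1 t + b * g1 t)
            (fun t => a * f2 t + b * g2 t).
Proof.
move=> [sf f01 f12] [sg g01 g12]; split; last 2 first.
- exact: has_L2_deriv_comb.
- exact: has_L2_deriv_comb.
- by apply: sqintD; exact: sqintZ.
Qed.

(** Lebesgue differentiation: a vanishing primitive has derivative zero, which equals [w] almost
    everywhere. *)
Lemma Rintegral_itv0_eq0 w : square_integrable w ->
  (forall x, Om x -> \int[mu]_(t in `[0, x]) w t = 0) -> ip w w = 0.
Proof.
move=> sw w0.
have iw := sqint_integrable sw.
(* Extended by zero, the function has a vanishing primitive up to every real end point, so
   differentiation can be applied on the line. *)
pose f := w \_ Om.
have iT : mu.-integrable setT (EFin \o f).
  by have := (integrable_mkcond (mu := mu) (EFin \o w) (@measurable_Omega R)).1 iw;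
    rewrite restrict_EFin.
have F0 y : \int[mu]_(t in `[0, y]) f t = 0.
  rewrite /f -Rintegral_mkcondr.
  have [y1|y1] := leP y 1.
    have [y0|y0] := leP 0 y; last by rewrite set_itv_ge ?set0I ?Rintegral_set0//
      bnd_simp -ltNge.
    have sub : `[0, y] `<=` Om by exact: itv_sub_Omega.
    by rewrite (setIidl sub) w0// OmegaE y0 y1.
  rewrite setIidr ?w0 ?OmegaE ?ler01 ?lexx//.
  by apply: subset_itv; rewrite bnd_simp// ltW.
have iy (y : R) : mu.-integrable `[0, y] (EFin \o f) by exact: integrableS iT.
have lf : locally_integrable setT f.
  split=> //; first by move/measurable_int/measurable_EFinP : iT.
    exact: openT.
  move=> K _ cK; have /integrableP[_] : mu.-integrable K (EFin \o f).
    by apply: integrableS iT => //; exact: compact_measurable.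
  by [].
have := FTC1 iy lf; rewrite (_ : (fun x => _) = cst 0); last by apply/funext.
move=> H; have ae0 : {ae mu, forall x, Om x -> (w x * w x)%:E = 0%E}.
  (* Differentiation is available only to the right of 0; the end point itself is one more null
     set. *)
  have n0 : {ae mu, forall x : R, x != 0}.
    exists [set 0]; split => //; first exact: lebesgue_measure_set1.
    by move=> x /= /negP; rewrite negbK => /eqP.
  move: n0; apply: filterS2 H; first exact: (ae_filter_ringOfSetsType mu).
  move=> x Hx x0 Ox.
  have Ox' := Ox; move: Ox'; rewrite OmegaE => /andP[x0' x1].
  have [|_] := Hx; first by rewrite /= lte_fin lt_def x0 x0'.
  rewrite derive1_cst /f patchE mem_set// => <-; by rewrite mulr0.
rewrite /ip /Rintegral (ae_eq_integral (cst 0%E))// ?integral0//.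
- exact: measurable_Omega.
- by have /integrable_OmegaP/measurable_EFinP := sqintM sw sw.
Qed.
End Sobolev.

Section Sobolev2.
Variable R : realType.
Implicit Types (f g h v w : R -> R) (a b c r s t x : R).
Notation mu := (@lebesgue_measure R).
Notation Om := (Omega R).

Lemma sqint_deriv_continuous g h : has_L2_deriv g h -> {within Om, continuous g}.
Proof.
move=> [sh gE]; apply: (@subspace_eq_continuous _ _ _
  (fun x => g 0 + \int[mu]_(t in `[0, x]) h t)).
  by move=> x; rewrite inE => Ox; rewrite /from_subspace/= [RHS]gE.
have cI := @parameterized_integral_continuous R 0 1 h ler01 (sqint_integrable sh).
by move=> x; exact: cvgD (cvg_cst _) (cI x).
Qed.

(* Letting the interval shrink in [taylor1] kills the derivative, so no
   differentiation theorem is needed here. *)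
Lemma W2_derivs0_deriv v v1 v2 : W2_derivs v v1 v2 -> (forall t, Om t -> v t = 0) ->
  forall t, Om t -> v1 t = 0.
Proof.
move=> [_ v01 v12] v0 r Or; apply/eqP; rewrite -normr_le0; apply/ler_addgt0Pr => e e0.
rewrite add0r.
pose N := L2norm v2; have N0 : 0 <= N by exact: L2norm_ge0.
(* Small enough that sqrt d * N <= e, with N + 1 avoiding a division by zero; at most 1 / 2, so that
   a window of length [d] starting or ending at [r] fits in [0, 1]. *)
pose d := Num.min (1 / 2) ((e / (N + 1)) ^+ 2).
have d0 : 0 < d by rewrite lt_min divr_gt0//= exprn_gt0// divr_gt0//; lra.
have d2 : d <= 1 / 2 by rewrite ge_min lexx.
have [a [a0 a1 ar]] : exists a, [/\ 0 <= a, a + d <= 1 & a <= r <= a + d].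
  move: Or; rewrite OmegaE => /andP[r0 r1].
  have [r2|r2] := leP r (1 / 2).
    by exists r; split; [lra|lra|apply/andP; split; lra].
  by exists (r - d); split; [lra|lra|apply/andP; split; lra].
have sa : a <= a <= a + d by apply/andP; split; lra.
have ta : a <= a + d <= a + d by apply/andP; split; lra.
have := taylor1 v01 v12 a0 a1 ar sa ta.
rewrite (v0 _ (itv_Omega a0 a1 sa)) (v0 _ (itv_Omega a0 a1 ta)).
rewrite (_ : a + d - a = d); last by ring.
rewrite subrr sub0r normrN normrM (gtr0_norm d0) mulrC ler_pM2l//.
move=> /le_trans; apply.
have : Num.sqrt d <= e / (N + 1).
  rewrite -(@ger0_norm _ (e / (N + 1))); last by apply: divr_ge0; lra.
  by rewrite -sqrtr_sqr ler_wsqrtr// /d ge_min lexx orbT.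
move=> /(ler_wpM2r N0) /le_trans; apply; rewrite mulrAC ler_pdivrMr; last lra.
by nra.
Qed.

Lemma sqint_ip0 w h : square_integrable w -> square_integrable h -> ip w w = 0 -> ip w h = 0.
Proof.
move=> sw sh w0; have := ip_CS sw sh; rewrite w0 mul0r => H.
by apply/eqP; rewrite -sqrf_eq0 eq_le H sqr_ge0.
Qed.

(** The difference of the two chains is a chain for the zero function, so its first derivative
    vanishes everywhere and its second has vanishing primitives. Hence any version may replace
    [second_deriv] inside [ip]. *)
Lemma second_deriv_unique g g1 g2 h1 h2 f : W2_derivs g g1 g2 -> W2_derivs g h1 h2 ->
  square_integrable f -> ip g2 f = ip h2 f.
Proof.
move=> Wg Wh sf.
have W := W2_derivs_comb 1 (-1) Wg Wh.
have z1 := W2_derivs0_deriv W; have {}z1 t : Om t -> 1 * g1 t + -1 * h1 t = 0.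
  by move=> Ot; apply: z1 => // s _; ring.
have [_ _ W12] := W.
have w0 : ip (fun t => 1 * g2 t + -1 * h2 t) (fun t => 1 * g2 t + -1 * h2 t) = 0.
  apply: Rintegral_itv0_eq0 W12.1 _ => x Ox.
  have := W12.2 x Ox; rewrite z1// z1 ?OmegaE ?lexx ?ler01// add0r => <- //.
have := sqint_ip0 W12.1 sf w0.
have [[_ _ [sg _]] [_ _ [sh _]]] := (Wg, Wh).
have := ipDl (sqintZ 1 sg) (sqintZ (-1) sh) sf; rewrite /= => -> .
by rewrite !ipZl// mul1r mulN1r => /eqP; rewrite subr_eq0 => /eqP.
Qed.

Lemma second_derivP g : W2 g -> exists g1, W2_derivs g g1 (second_deriv g).
Proof.
move=> [g1 [g2 W]]; rewrite /second_deriv; case: xgetP => [_ -> //|/(_ g2) []].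
by exists g1.
Qed.

Lemma ip_second_deriv g g1 g2 f : W2_derivs g g1 g2 -> square_integrable f ->
  ip (second_deriv g) f = ip g2 f.
Proof.
move=> W sf; have [h1 W'] : exists g1, W2_derivs g g1 (second_deriv g).
  by apply: second_derivP; exists g1, g2.
exact: second_deriv_unique W' W sf.
Qed.

Lemma sqint_second_deriv g : W2 g -> square_integrable (second_deriv g).
Proof. by move=> /second_derivP[g1 [_ _ []]]. Qed.

(** The truncated power (x - t)_+: the kernel of twofold integration from 0, and the building block
    for second derivatives of cubic splines with a knot at [x]. *)
Definition ramp x t : R := Num.max (x - t) 0.

Lemma sqint_ramp x : square_integrable (ramp x).
Proof.
apply: continuous_sqint; apply: continuous_subspaceT.
apply: (max_fun_continuous (f := fun t : R => x - t) (g := cst 0)); last exact: cst_continuous.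
by move=> t; apply: continuousB; [exact: cst_continuous|exact: cvg_id].
Qed.

(** Fubini on the triangle 0 <= t <= s <= x: for fixed [t], the variable [s] runs over a length (x -
    t)_+. *)
Lemma iterated_integral h x : square_integrable h -> Om x ->
  \int[mu]_(s in `[0, x]) (\int[mu]_(t in `[0, s]) h t) = ip (ramp x) h.
Proof.
move=> sh Ox; have := Ox; rewrite OmegaE => /andP[x0 x1].
have mO := @measurable_Omega R.
pose H := h \_ Om.
(* Both domains of integration are put into the integrand, so that Fubini runs over the plane;
   writing t <= s as an indicator of s - t makes joint measurability evident. *)
pose phi (z : R * R) : R := \1_(`[0, x]) z.1 * \1_(`[0, +oo[) (z.1 - z.2) * H z.2.
have mH : measurable_fun setT H by apply/(measurable_restrictT _ mO); exact: sh.1.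
have mphi : measurable_fun setT phi.
  apply: measurable_funM; last exact: measurableT_comp.
  apply: measurable_funM; apply: measurableT_comp => //; exact: measurable_funB.
have intr (A : set R) (f : R -> \bar R) :
    (\int[mu]_t ((f \_ A) t) = \int[mu]_(t in A) f t)%E by rewrite -integral_mkcond.
have int0E (f : R -> \bar R) : (forall t, f t = 0%E) -> (\int[mu]_t f t = 0)%E.
  by move=> f0; apply: integral0_eq.
have inner1 c t : Om t ->
    (\int[mu]_s (\1_(`[0, x]) s * \1_(`[0, +oo[) (s - t) * c)%:E = (ramp x t * c)%:E)%E.
  rewrite OmegaE => /andP[t0 t1].
  transitivity (\int[mu]_s ((cst c%:E \_ `[t, x]) s))%E.
    apply: eq_integral => s _; rewrite patchE !indicE !mem_setE !in_itv/= andbT subr_ge0.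
    case: (leP t s) => ts; last by rewrite mulr0 mul0r.
    by rewrite (le_trans t0 ts)/=; case: ifP; rewrite ?(mul1r,mul0r,mulr1).
  rewrite intr; transitivity (c%:E * mu `[t, x])%E; first exact: integral_cst.
  rewrite lebesgue_measure_itv/= lte_fin /ramp.
  case: ltP => tx; first by rewrite -EFinB -EFinM mulrC max_l// subr_ge0 ltW.
  by rewrite mule0 max_r ?mul0r// subr_le0.
have inner2 s : 0 <= s <= x ->
    (\int[mu]_t (phi (s, t))%:E = (\int[mu]_(t in `[0%R, s]) h t)%:E)%E.
  move=> /andP[s0 sx].
  have sub : `[0, s] `<=` Om by apply: itv_sub_Omega => //; exact: le_trans sx x1.
  transitivity (\int[mu]_(t in `[0%R, s]) (h t)%:E)%E.
    rewrite -[RHS]intr; apply: eq_integral => t _;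
      rewrite patchE /phi/= /H patchE !indicE !mem_setE !in_itv/= andbT subr_ge0 s0 sx mul1r.
    case: (leP t s) => ts; last by rewrite mul0r andbF.
    rewrite mul1r andbT; case: (leP 0 t) => t0//.
    by rewrite (le_trans ts (le_trans sx x1)).
  rewrite /Rintegral fineK//.
  apply: integrable_fin_num => //.
  exact: integrable_sub_Omega (sqint_integrable sh).
have inner2' s : ~~ (0 <= s <= x) -> (\int[mu]_t (phi (s, t))%:E = 0)%E.
  move=> sx; apply: int0E => t.
  by rewrite /phi/= indicE mem_setE in_itv/= (negbTE sx) !mul0r.
have H0 t : ~ Om t -> H t = 0 by move=> Ot; rewrite /H patchE memNset.
have HE t : Om t -> H t = h t by move=> Ot; rewrite /H patchE mem_set.
have iphi : (mu \x mu)%E.-integrable setT (EFin \o phi).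
  apply/integrable21ltyP; first exact/measurable_EFinP.
  have -> : (\int[mu]_t \int[mu]_s `|(EFin \o phi) (s, t)| =
      \int[mu]_(t in Om) (ramp x t * `|h t|)%:E)%E.
    rewrite -[RHS]intr; apply: eq_integral => t _; rewrite patchE.
    have [Ot|Ot] := pselect (Om t); [rewrite mem_set//|rewrite memNset//].
      rewrite -inner1//; apply: eq_integral => s _ /=; rewrite !normrM HE//.
      rewrite /=; congr EFin; congr (_ * _ * _); rewrite ger0_norm//.
    transitivity (0%E : \bar R); last by [].
    by apply: int0E => s /=; rewrite /phi H0 ?mulr0 ?normr0//.
  have /integrableP[_] := sqintM (sqint_ramp x) sh.
  have -> : (\int[mu]_(t in Om) `|(ramp x t * h t)%:E| =
      \int[mu]_(t in Om) (ramp x t * `|h t|)%:E)%E.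
    apply: eq_integral => t _ /=.
    by rewrite normrM ger0_norm// /ramp le_max lexx orbT.
  by [].
have := Fubini iphi.
have -> : (\int[mu]_s \int[mu]_t ((EFin \o phi) (s, t)) =
    \int[mu]_(s in `[0%R, x]) (\int[mu]_(t in `[0%R, s]) h t)%:E)%E.
  rewrite -[RHS]intr; apply: eq_integral => s _; rewrite patchE; case: ifPn;
    rewrite mem_setE in_itv/=.
    exact: inner2.
  exact: inner2'.
have -> : (\int[mu]_t \int[mu]_s ((EFin \o phi) (s, t)) =
    \int[mu]_(t in Om) (ramp x t * h t)%:E)%E.
  rewrite -[RHS]intr; apply: eq_integral => t _; rewrite patchE.
  have [Ot|Ot] := pselect (Om t); [rewrite mem_set//|rewrite memNset//].
    by rewrite -inner1//; apply: eq_integral => s _ /=; rewrite /phi/= HE.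
  transitivity (0%E : \bar R); last by [].
  by apply: int0E => s /=; rewrite /phi H0 ?mulr0.
by move=> E; rewrite /ip /Rintegral -E.
Qed.

(** This makes a point value an affine part plus a pairing with [v2], which is how data terms are
    turned into inner products. *)
Lemma taylor_integral v v1 v2 x : W2_derivs v v1 v2 -> Om x ->
  v x = v 0 + v1 0 * x + ip (ramp x) v2.
Proof.
move=> [_ v01 v12] Ox; rewrite -iterated_integral//; last exact: v12.1.
have sub : `[0, x] `<=` Om.
  by move: Ox; rewrite OmegaE => /andP[_ ?]; exact: itv_sub_Omega.
have x0 : 0 <= x by move: Ox; rewrite OmegaE => /andP[].
have mx : fine (mu `[0, x]) = x.
  by rewrite lebesgue_measure_itv/= lte_fin; case: ltP => //= ts; lra.
have E s : s \in `[0, x]%classic -> \int[mu]_(t in `[0, s]) v2 t = v1 s - v1 0.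
  by move=> /set_mem/sub Os; rewrite (v12.2 s Os); ring.
have -> : \int[mu]_(s in `[0, x]) (\int[mu]_(t in `[0, s]) v2 t) =
    \int[mu]_(s in `[0, x]) (v1 s - v1 0) by apply: eq_Rintegral => s sx; exact: E.
have i1 := integrable_sub_Omega (measurable_itv _) sub (sqint_integrable v01.1).
have i2 := integrable_sub_Omega (measurable_itv _) sub (integrable_Omega_cst (v1 0)).
by rewrite (RintegralB (f2 := cst (v1 0)) _ i1 i2)// Rintegral_cst// mx (v01.2 x Ox); ring.
Qed.

Lemma W2_derivs_primitive a b h : square_integrable h ->
  let u1 := fun s => b + \int[mu]_(t in `[0, s]) h t in
  W2_derivs (fun x => a + \int[mu]_(s in `[0, x]) u1 s) u1 h.
Proof.
move=> sh u1.
have d1 : has_L2_deriv u1 h.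
  by split=> // x _; rewrite /u1 set_itv1 Rintegral_set1 addr0.
have s1 : square_integrable u1 by apply/continuous_sqint/sqint_deriv_continuous/d1.
have d0 : has_L2_deriv (fun x => a + \int[mu]_(s in `[0, x]) u1 s) u1.
  by split=> // x _; rewrite set_itv1 Rintegral_set1 addr0.
by split=> //; exact/continuous_sqint/sqint_deriv_continuous/d0.
Qed.

Lemma W2_with_second_deriv a b h : square_integrable h ->
  exists u u1, W2_derivs u u1 h /\ forall x, Om x -> u x = a + b * x + ip (ramp x) h.
Proof.
move=> sh; have W := W2_derivs_primitive a b sh.
exists (fun x => a + \int[mu]_(s in `[0, x]) (b + \int[mu]_(t in `[0, s]) h t)).
exists (fun s => b + \int[mu]_(t in `[0, s]) h t); split=> // x Ox.
by rewrite (taylor_integral W Ox) !set_itv1 !Rintegral_set1 !addr0.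
Qed.
End Sobolev2.

(** * The penalized energy and existence of the smoothing spline *)

Section Energy.
Variable R : realType.
Notation Om := (Omega R).

Lemma sqint_sum (I : Type) (r : seq I) (F : I -> R -> R) (c : I -> R) :
  (forall i, square_integrable (F i)) ->
  square_integrable (fun t => \sum_(i <- r) c i * F i t).
Proof.
move=> sF; elim: r => [|i r IH].
  by under eq_fun do rewrite big_nil; exact: sqint_cst.
under eq_fun do rewrite big_cons.
by apply: (@sqintD _ (fun t => c i * F i t)) => //; exact: sqintZ.
Qed.

Lemma ip0l (h : R -> R) : ip (fun=> 0) h = 0.
Proof. by rewrite /ip /Rintegral integral0_eq// => t _; rewrite mul0r. Qed.

Lemma ip_suml (I : Type) (r : seq I) (F : I -> R -> R) (c : I -> R) h :
  (forall i, square_integrable (F i)) -> square_integrable h ->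
  ip (fun t => \sum_(i <- r) c i * F i t) h = \sum_(i <- r) c i * ip (F i) h.
Proof.
move=> sF sh; elim: r => [|i r IH].
  under eq_fun do rewrite big_nil; rewrite big_nil.
  exact: ip0l.
under eq_fun do rewrite big_cons.
rewrite big_cons -IH -ipZl//; apply: (@ipDl _ (fun t => c i * F i t)) => //.
- exact: sqintZ.
- exact: sqint_sum.
Qed.

Lemma W2_comb (a b : R) f g : W2 f -> W2 g -> W2 (fun t => a * f t + b * g t).
Proof.
move=> [f1 [f2 Wf]] [g1 [g2 Wg]].
by exists (fun t => a * f1 t + b * g1 t), (fun t => a * f2 t + b * g2 t); exact: W2_derivs_comb.
Qed.

Lemma ip_second_deriv_comb (a b : R) f g h : W2 f -> W2 g -> square_integrable h ->
  ip (second_deriv (fun t => a * f t + b * g t)) h =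
  a * ip (second_deriv f) h + b * ip (second_deriv g) h.
Proof.
move=> Wf Wg sh.
have [[f1 Wf'] [g1 Wg']] := (second_derivP Wf, second_derivP Wg).
rewrite (ip_second_deriv (W2_derivs_comb a b Wf' Wg') sh).
have [sf sg] := (sqint_second_deriv Wf, sqint_second_deriv Wg).
rewrite -!ipZl//; apply: (@ipDl _ (fun t => a * _) (fun t => b * _)) => //; exact: sqintZ.
Qed.

Lemma W2_cst0 : W2 (fun=> 0 : R).
Proof.
have [u [u1 [W uE]]] := W2_with_second_deriv 0 0 (sqint_cst (0:R)).
exists u1, (cst 0); apply: eq_W2_derivs W => t /set_mem Ot.
by rewrite uE// mul0r !add0r ipC ip0l.
Qed.

Lemma W2_sum (I : Type) (r : seq I) (F : I -> R -> R) (c : I -> R) :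
  (forall i, W2 (F i)) -> W2 (fun t => \sum_(i <- r) c i * F i t).
Proof.
move=> WF; elim: r => [|i r IH].
  by under eq_fun do rewrite big_nil; exact: W2_cst0.
under eq_fun do rewrite big_cons.
have := W2_comb (c i) 1 (WF i) IH.
by under eq_fun do rewrite mul1r.
Qed.

Variables (lam : R) (n : nat) (x : 'I_n -> R).
Hypothesis lam_gt0 : 0 < lam.

(** The symmetric bilinear form whose diagonal is the spline objective for zero data; minimization
    then amounts to completing a square. *)
Definition energy (u v : R -> R) : R :=
  n%:R^-1 * \sum_(i < n) u (x i) * v (x i)
  + lam * ip (second_deriv u) (second_deriv v).

Lemma energyC u v : energy u v = energy v u.
Proof. by rewrite /energy ipC; under eq_bigr do rewrite mulrC. Qed.

Lemma energy_combl (a b : R) f g h : W2 f -> W2 g -> W2 h ->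
  energy (fun t => a * f t + b * g t) h = a * energy f h + b * energy g h.
Proof.
move=> Wf Wg Wh; rewrite /energy ip_second_deriv_comb//; last exact: sqint_second_deriv.
under eq_bigr do rewrite mulrDl -!mulrA.
rewrite big_split/= -!mulr_sumr; ring.
Qed.

Lemma energy_ge0 u : 0 <= energy u u.
Proof.
rewrite addr_ge0// mulr_ge0 ?ip_ge0 ?invr_ge0 ?ler0n// ?(ltW lam_gt0)//.
by apply: sumr_ge0 => i _; rewrite -expr2 sqr_ge0.
Qed.

Lemma energy_comb (a b : R) f g : W2 f -> W2 g ->
  energy (fun t => a * f t + b * g t) (fun t => a * f t + b * g t) =
  a ^+ 2 * energy f f + 2 * a * b * energy f g + b ^+ 2 * energy g g.
Proof.
move=> Wf Wg; have W := W2_comb a b Wf Wg.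
rewrite energy_combl// (energyC f (fun t => _)) (energyC g (fun t => _)) !energy_combl//
  (energyC g f); ring.
Qed.

Lemma energy_suml (I : Type) (r : seq I) (F : I -> R -> R) (c : I -> R) h :
  (forall i, W2 (F i)) -> W2 h ->
  energy (fun t => \sum_(i <- r) c i * F i t) h = \sum_(i <- r) c i * energy (F i) h.
Proof.
move=> WF Wh; elim: r => [|i r IH].
  have := energy_combl 0 0 W2_cst0 W2_cst0 Wh.
  rewrite [RHS](_ : _ = 0); last by ring.
  move=> E0; rewrite big_nil -[RHS]E0.
  by congr energy; apply/funext => t; rewrite big_nil; ring.
rewrite big_cons -IH -[X in _ + X]mul1r -energy_combl//; last exact: W2_sum.
by congr energy; apply/funext => t; rewrite big_cons mul1r.
Qed.

Lemma spline_objectiveE (y : 'I_n -> R) g :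
  spline_objective lam x y g =
  energy g g - 2 * (n%:R^-1 * \sum_(i < n) g (x i) * y i) + n%:R^-1 * \sum_(i < n) y i ^+ 2.
Proof.
rewrite /spline_objective /energy.
have -> : \sum_(i < n) (g (x i) - y i) ^+ 2 = \sum_(i < n) g (x i) * g (x i)
    - 2 * (\sum_(i < n) g (x i) * y i) + \sum_(i < n) y i ^+ 2.
  by rewrite mulr_sumr -sumrB -big_split/=; apply: eq_bigr => i _; ring.
have -> : \int[@lebesgue_measure R]_(t in Om) (second_deriv g t) ^+ 2 =
    ip (second_deriv g) (second_deriv g) by apply: eq_Rintegral => t _; rewrite expr2.
ring.
Qed.

Hypothesis x_Om : forall i, Om (x i).
Hypothesis n_gt0 : (0 < n)%N.
Hypothesis x_distinct : exists i j, x i != x j.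

Let nR_gt0 : 0 < n%:R :> R. Proof. by rewrite ltr0n. Qed.

(** The unknowns are the ramp coefficients [c] and the affine part [d] of a spline. The block [X]
    imposes sum c_i = sum c_i x_i = 0, the natural boundary condition: the second derivative
    vanishes to the left of all design points. *)
Let G : 'M[R]_n := \matrix_(i, j) ip (ramp (x i)) (ramp (x j)).
Let K : 'M[R]_n := G + (n%:R * lam)%:M.
Let X : 'M[R]_(n, 2) := \matrix_(i, k) (if k == 0 then 1 else x i).
Let M : 'M[R]_(n + 2) := block_mx K X X^T 0.

Let quadE (c : 'rV[R]_n) :
  (c *m G *m c^T) 0 0 = ip (fun t => \sum_(i < n) c 0 i * ramp (x i) t)
                           (fun t => \sum_(i < n) c 0 i * ramp (x i) t).
Proof.
have sr i : square_integrable (ramp (x i)) by exact: sqint_ramp.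
rewrite ip_suml//; last exact: sqint_sum.
rewrite -mulmxA mxE; apply: eq_bigr => i _; congr *%R.
rewrite ipC ip_suml// mxE; apply: eq_bigr => j _.
by rewrite !mxE mulrC ipC.
Qed.

(** For a left null vector (c, d), pairing the first block with [c] removes [d] because c X = 0, and
    what is left is a nonnegative Gram form plus n lambda |c|^2. So c = 0, and [d] gives an affine
    function vanishing at two distinct design points. *)
Let sys_unit : M \in unitmx.
Proof.
rewrite -row_free_unit; apply: inj_row_free => w.
rewrite -[w]hsubmxK; set c := lsubmx w; set d := rsubmx w.
rewrite mul_row_block mulmx0 addr0 -[0]row_mx0 => /eq_row_mx[e1 e2].
have c0 : c = 0.
  have : (c *m K + d *m X^T) *m c^T = 0 by rewrite e1 mul0mx.
  rewrite mulmxDl -(mulmxA d) -trmx_mul e2 trmx0 mulmx0 addr0.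
  rewrite /K mulmxDr mulmxDl mul_mx_scalar -scalemxAl => /matrixP/(_ 0 0).
  rewrite [LHS]mxE quadE [X in _ + X = _]mxE [X in _ * X]mxE [RHS]mxE => H.
  have pos i : 0 <= c 0 i * c^T i 0 by rewrite [c^T i 0]mxE -expr2 sqr_ge0.
  have s0 : 0 <= \sum_j c 0 j * c^T j 0 by exact: sumr_ge0.
  have /eqP : \sum_j c 0 j * c^T j 0 = 0.
    have := ip_ge0 (fun t => \sum_(i < n) c 0 i * ramp (x i) t).
    have : 0 < n%:R * lam by rewrite mulr_gt0.
    by move: H s0; set S := \sum_j _ => ? ? ? ?; nra.
  rewrite psumr_eq0//.
  move=> /allP H0; apply/rowP => i; have := H0 i (mem_index_enum _).
  by rewrite [c^T i 0]mxE /= -expr2 sqrf_eq0 [RHS]mxE => /eqP.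
rewrite c0 mul0mx add0r in e1.
have e i : d 0 0 + d 0 1 * x i = 0.
  have /matrixP/(_ 0 i) := e1; rewrite !mxE !big_ord_recl big_ord0 !mxE /= mulr1 addr0.
  by rewrite (_ : lift _ _ = 1)//; exact/val_inj.
have [i [j xij]] := x_distinct.
have d1 : d 0 1 = 0.
  have /eqP : d 0 1 * (x i - x j) = 0 by have := e i; have := e j; lra.
  by rewrite mulf_eq0 subr_eq0 (negbTE xij) orbF => /eqP.
have d0 : d 0 0 = 0 by have := e i; rewrite d1 mul0r addr0.
have -> : d = 0.
  apply/rowP => k; rewrite [RHS]mxE; case: k => [[|[|//]]] lk;
    [rewrite -[RHS]d0|rewrite -[RHS]d1];
  by congr (d 0 _); exact/val_inj.
by rewrite c0 row_mx0.
Qed.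

(* The representer is a natural cubic spline: its second derivative is a
   combination of the ramps at the design points, with coefficients solving the
   system [M], which is injective because [G] is a Gram matrix. *)
Lemma energy_representer (y : 'I_n -> R) : exists2 u, W2 u &
  forall v, W2 v -> energy u v = n%:R^-1 * \sum_(i < n) y i * v (x i).
Proof.
pose w := row_mx (\row_i y i) 0 *m invmx M; pose c := lsubmx w; pose d := rsubmx w.
have wM : row_mx (c *m K + d *m X^T) (c *m X) = row_mx (\row_i y i) 0.
  have : w *m M = row_mx (\row_i y i) 0 by rewrite /w mulmxKV// sys_unit.
  by rewrite -[w]hsubmxK mul_row_block mulmx0 addr0.
have {wM}[e1 e2] := eq_row_mx wM.
have c1 : \sum_(i < n) c 0 i = 0.
  have := congr1 (fun A : 'M[R]_(1, 2) => A 0 0) e2; rewrite [LHS]mxE [RHS]mxE => e;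
    rewrite -[RHS]e; apply: eq_bigr => i _.
  by rewrite [X i 0]mxE mulr1.
have cx : \sum_(i < n) c 0 i * x i = 0.
  have := congr1 (fun A : 'M[R]_(1, 2) => A 0 1) e2; rewrite [LHS]mxE [RHS]mxE => e;
    rewrite -[RHS]e; apply: eq_bigr => i _.
  by rewrite [X i 1]mxE.
have sr i : square_integrable (ramp (x i)) by exact: sqint_ramp.
pose h t := \sum_(i < n) c 0 i * ramp (x i) t.
have sh : square_integrable h by exact: sqint_sum.
have [u [u1 [Wu uE]]] := W2_with_second_deriv (d 0 0) (d 0 1) sh.
have W2u : W2 u by exists u1, h.
have fit i : u (x i) = y i - n%:R * lam * c 0 i.
  have := congr1 (fun A : 'rV[R]_n => A 0 i) e1.
  rewrite /K mulmxDr mul_mx_scalar [LHS]mxE [in X in X + _]mxE [in X in _ + X + _]mxE.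
  rewrite [(d *m _) 0 i]mxE !big_ord_recl big_ord0 [(\row_i y i) 0 i]mxE.
  rewrite ![X^T _ _]mxE ![X _ _]mxE/= (_ : lift ord0 ord0 = 1); last exact/val_inj.
  move=> <-; rewrite uE//.
  have -> : ip (ramp (x i)) h = (c *m G) 0 i.
    by rewrite ipC ip_suml// [RHS]mxE; apply: eq_bigr => j _; rewrite [G j i]mxE.
  ring.
exists u => // v Wv; have [v1 Wv'] := second_derivP Wv.
have sv := sqint_second_deriv Wv.
rewrite /energy (ip_second_deriv Wu)// ip_suml//.
under eq_bigr do rewrite fit mulrBl.
rewrite sumrB mulrBr.
(* The residuals n lambda c_i pair with [v] as the penalty does: the side conditions on [c]
   annihilate the affine part of Taylor's formula. *)
have -> : \sum_(i < n) n%:R * lam * c 0 i * v (x i) =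
    n%:R * lam * \sum_(i < n) c 0 i * ip (ramp (x i)) (second_deriv v).
  rewrite mulr_sumr.
  have -> : \sum_(i < n) n%:R * lam * c 0 i * v (x i) =
      n%:R * lam * (v 0 * \sum_(i < n) c 0 i + v1 0 * \sum_(i < n) c 0 i * x i) +
      \sum_(i < n) n%:R * lam * (c 0 i * ip (ramp (x i)) (second_deriv v)).
    rewrite !mulr_sumr -big_split mulr_sumr -big_split/=; apply: eq_bigr => i _.
    by rewrite (taylor_integral Wv' (x_Om i)); ring.
  by rewrite c1 cx; ring.
by field; rewrite gt_eqF.
Qed.

(** For the representer [u] of the data, the objective at [h] exceeds that at [u] by the energy of h
    - u. So a minimizer exists, and the default value of [smoothing_spline] is not taken. *)
Lemma smoothing_splineP (y : 'I_n -> R) :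
  is_smoothing_spline lam x y (smoothing_spline lam x y).
Proof.
rewrite /smoothing_spline; case: xgetP => [g -> //|H].
have [u Wu uE] := energy_representer y.
case: (H u); split=> // h Wh; rewrite -subr_ge0 !spline_objectiveE.
have -> : \sum_(i < n) u (x i) * y i = n%:R * energy u u.
  by rewrite uE// mulrA mulfV ?gt_eqF// mul1r; apply: eq_bigr => i _; rewrite mulrC.
have -> : \sum_(i < n) h (x i) * y i = n%:R * energy u h.
  by rewrite uE// mulrA mulfV ?gt_eqF// mul1r; apply: eq_bigr => i _; rewrite mulrC.
have := energy_ge0 (fun t => 1 * h t + -1 * u t); rewrite energy_comb// (energyC h u).
by rewrite !mulKf ?gt_eqF//; lra.
Qed.

End Energy.

(** * Deterministic error bound *)

Section Oracle.
Variable R : realType.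
Notation Om := (Omega R).
Variables (lam : R) (n : nat) (x : 'I_n -> R).
Hypotheses (lam_gt0 : 0 < lam) (n_gt0 : (0 < n)%N).
Hypothesis x_Om : forall i, Om (x i).
Hypothesis x_distinct : exists i j, x i != x j.

Notation energy := (energy lam x).

Let nR_gt0 : 0 < n%:R :> R. Proof. by rewrite ltr0n. Qed.

Lemma unit_representers : exists U : 'I_n -> R -> R, forall j, W2 (U j) /\
  forall v, W2 v -> energy (U j) v = n%:R^-1 * v (x j).
Proof.
suff /choice[U HU] : forall j, exists u, W2 u /\ forall v, W2 v ->
  energy u v = n%:R^-1 * v (x j).
  by exists U.
move=> j; have [u Wu uE] := energy_representer lam_gt0 x_Om n_gt0 x_distinct (fun i =>
  (i == j)%:R).
exists u; split=> // v Wv; rewrite uE// (bigD1 j)//= eqxx mul1r big1 ?addr0// => i /negPf ->.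
by rewrite mul0r.
Qed.

Variable U : 'I_n -> R -> R.
Hypothesis WU : forall j, W2 (U j).
Hypothesis UE : forall j v, W2 v -> energy (U j) v = n%:R^-1 * v (x j).

(** Written without second derivatives, so that its expectation can be taken term by term. *)
Definition noise_energy (e : 'I_n -> R) : R :=
  n%:R^-1 * \sum_(i < n) \sum_(j < n) e i * e j * U j (x i).

Lemma noise_energyE e : noise_energy e =
  energy (fun t => \sum_(i < n) e i * U i t) (fun t => \sum_(i < n) e i * U i t).
Proof.
have WS : W2 (fun t => \sum_(i < n) e i * U i t) by exact: W2_sum.
rewrite energy_suml//; under [RHS]eq_bigr do rewrite UE// mulr_sumr mulr_sumr.
rewrite /noise_energy mulr_sumr; apply: eq_bigr => i _; rewrite mulr_sumr.
by apply: eq_bigr => j _; ring.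
Qed.

Variable K : R.
Hypothesis K_ge0 : 0 <= K.
Hypothesis Kb : forall v, W2 v -> forall t, Om t -> v t ^+ 2 <= K * energy v v.

(** The sup bound for U_j at its own point reads U_j(x_j)^2 <= K U_j(x_j) / n, and one factor
    cancels. *)
Lemma representer_diag j : U j (x j) <= K / n%:R.
Proof.
have := Kb (WU j) (x_Om j); rewrite UE//; set z := U j (x j) => H.
have [z0|z0] := leP z 0; first by rewrite (le_trans z0)// divr_ge0// ltW.
by move: H; rewrite expr2 mulrA ler_pM2r.
Qed.

(** Minimality is used only against [f]. Twice that comparison, added to lambda times |v''|^2 <= 2
    |g''|^2 + 2 |f''|^2, gives both factors 4. *)
Lemma oracle_inequality (f g : R -> R) (w : 'I_n -> R) (y : 'I_n -> R) :
  W2 f -> is_smoothing_spline lam x y g -> (forall i, y i = f (x i) + w i) ->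
  forall v, v = (fun t => 1 * g t + -1 * f t) ->
  energy v v <= 4 * (n%:R^-1 * \sum_(i < n) w i * v (x i))
    + 4 * lam * ip (second_deriv f) (second_deriv f).
Proof.
move=> Wf [Wg gmin] yE v vE.
have Wv : W2 v by rewrite vE; exact: W2_comb.
have [sf sg] := (sqint_second_deriv Wf, sqint_second_deriv Wg).
have := gmin _ Wf; rewrite !spline_objectiveE.
have expand (h : R -> R) : n%:R^-1 * (\sum_(i < n) h (x i) * h (x i))
    - 2 * (n%:R^-1 * \sum_(i < n) h (x i) * y i) + n%:R^-1 * (\sum_(i < n) y i ^+ 2)
    = n%:R^-1 * \sum_(i < n) (h (x i) - y i) ^+ 2.
  rewrite -[LHS](_ : n%:R^-1 * (\sum_(i < n) h (x i) * h (x i)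
    - 2 * (\sum_(i < n) h (x i) * y i) + \sum_(i < n) y i ^+ 2) = _); last by ring.
  congr *%R; rewrite mulr_sumr -sumrB -big_split/=; apply: eq_bigr => i _; ring.
have vx i : g (x i) = f (x i) + v (x i) by rewrite vE; ring.
have Eg : n%:R^-1 * (\sum_(i < n) (g (x i) - y i) ^+ 2) =
  n%:R^-1 * (\sum_(i < n) v (x i) * v (x i)) - 2 * (n%:R^-1 * \sum_(i < n) w i * v (x i))
  + n%:R^-1 * \sum_(i < n) (f (x i) - y i) ^+ 2.
  rewrite -[RHS](_ : n%:R^-1 * (\sum_(i < n) v (x i) * v (x i)
    - 2 * (\sum_(i < n) w i * v (x i)) + \sum_(i < n) (f (x i) - y i) ^+ 2) = _); last by ring.
  by congr *%R; rewrite mulr_sumr -sumrB -big_split/=; apply: eq_bigr => i _;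
    rewrite vx yE; ring.
have bv : ip (second_deriv v) (second_deriv v) <=
    2 * ip (second_deriv g) (second_deriv g) + 2 * ip (second_deriv f) (second_deriv f).
  have vl h : square_integrable h -> ip (second_deriv v) h =
      1 * ip (second_deriv g) h + -1 * ip (second_deriv f) h.
    by move=> sh; rewrite vE ip_second_deriv_comb.
  rewrite vl; last exact: sqint_second_deriv.
  rewrite (ipC (second_deriv g)) (ipC (second_deriv f)) !vl// (ipC (second_deriv f)
    (second_deriv g)).
  have := ip_ge0 (fun t => 1 * second_deriv g t + 1 * second_deriv f t).
  by rewrite ip_comb//; lra.
have v0 : 0 <= n%:R^-1 * \sum_(i < n) v (x i) * v (x i).
  by rewrite mulr_ge0// ?invr_ge0 ?ler0n// sumr_ge0// => i _; rewrite -expr2 sqr_ge0.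
move: (expand f) (expand g) Eg v0; rewrite /energy.
set a1 := n%:R^-1 * _; set a2 := n%:R^-1 * _; set a3 := n%:R^-1 * _.
have := ler_wpM2l (ltW lam_gt0) bv.
lra.
Qed.

Lemma oracle_sup_bound (f : R -> R) (m1 m2 : R) (q : nat) (e : 'I_n -> R)
    (S : {set 'I_n} * ('I_n -> R)) t :
  0 <= m1 -> 0 <= m2 -> admissible m1 f -> strategies q m2 S -> Om t ->
  (f t - smoothing_spline lam x (observed f x e S) t) ^+ 2 <=
  K * (32 * noise_energy e
       + 64 * (K * (q%:R / n%:R)) * ((m1 + m2) ^+ 2 + n%:R^-1 * \sum_(i < n) e i ^+ 2)
       + 8 * lam * ip (second_deriv f) (second_deriv f)).
Proof.
move=> m10 m20 [Wf fm1] [cardA Sm2] Ot.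
set y := observed f x e S; set g := smoothing_spline _ _ _.
have gP : is_smoothing_spline lam x y g by exact: smoothing_splineP.
(* The replaced noise is subtracted again, so that the full noise vector appears at every point;
   this brings the mean square of the noise into the bound on the corruption. *)
pose z i := if i \in S.1 then S.2 i - f (x i) - e i else 0.
have yE i : y i = f (x i) + (e i + z i).
  by rewrite /y /observed /z; case: ifP => _; ring.
pose v := fun t => 1 * g t + -1 * f t.
have Wv : W2 v by apply: W2_comb => //; exact: gP.1.
have vt : (f t - g t) ^+ 2 = v t ^+ 2 by rewrite /v; ring.
rewrite vt; apply: le_trans (Kb Wv Ot) _; rewrite ler_wpM2l//.
have := oracle_inequality Wf gP yE (erefl v).
set E := energy v v; set B := ip (second_deriv f) (second_deriv f) => H.
have E0 : 0 <= E by exact: energy_ge0.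
pose W t := \sum_(i < n) e i * U i t.
have WW : W2 W by exact: W2_sum.
(* Both error terms are absorbed by Young's inequality, each giving away [E / 4]. *)
have noise : 4 * (n%:R^-1 * \sum_(i < n) e i * v (x i)) <= E / 4 + 16 * noise_energy e.
  have -> : n%:R^-1 * (\sum_(i < n) e i * v (x i)) = energy W v.
    by rewrite energy_suml// mulr_sumr; apply: eq_bigr => i _; rewrite UE//; ring.
  rewrite noise_energyE -/W.
  have := energy_ge0 x lam_gt0 (fun t => 4 * W t + - (1 / 2) * v t).
  by rewrite energy_comb// -/E; lra.
have adv : 4 * (n%:R^-1 * \sum_(i < n) z i * v (x i)) <=
    E / 4 + 32 * (K * (q%:R / n%:R)) * ((m1 + m2) ^+ 2 + n%:R^-1 * \sum_(i < n) e i ^+ 2).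
  pose k : R := q%:R / n%:R.
  have k0 : 0 <= k by rewrite divr_ge0.
  (* The indicator costs nothing, as [z] vanishes off the corrupted set; after Cauchy-Schwarz it
     leaves at most [q] values of [v], each controlled by the sup bound. *)
  pose a i : R := (i \in S.1)%:R.
  pose Z := n%:R^-1 * \sum_(i < n) z i ^+ 2.
  pose V := n%:R^-1 * \sum_(i < n) (a i * v (x i)) ^+ 2.
  have ni0 : 0 <= n%:R^-1 :> R by rewrite invr_ge0.
  have Z0 : 0 <= Z by rewrite mulr_ge0// sumr_ge0// => i _; exact: sqr_ge0.
  have V0 : 0 <= V by rewrite mulr_ge0// sumr_ge0// => i _; exact: sqr_ge0.
  have zv : \sum_(i < n) z i * v (x i) = \sum_(i < n) z i * (a i * v (x i)).
    by apply: eq_bigr => i _; rewrite /z /a; case: (i \in S.1); rewrite ?mul1r// !mul0r.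
  have CS : (n%:R^-1 * \sum_(i < n) z i * v (x i)) ^+ 2 <= Z * V.
    apply: quadratic_form_CS => // r s; rewrite zv.
    have -> : r ^+ 2 * Z + 2 * r * s * (n%:R^-1 * \sum_(i < n) z i * (a i * v
      (x i))) + s ^+ 2 * V =
        n%:R^-1 * \sum_(i < n) (r * z i + s * (a i * v (x i))) ^+ 2.
      transitivity (n%:R^-1 * (r ^+ 2 * (\sum_(i < n) z i ^+ 2)
        + 2 * r * s * (\sum_(i < n) z i * (a i * v (x i)))
        + s ^+ 2 * \sum_(i < n) (a i * v (x i)) ^+ 2)); first by rewrite /Z /V; ring.
      by congr *%R; rewrite !mulr_sumr -!big_split/=; apply: eq_bigr => i _; ring.
    by rewrite mulr_ge0// sumr_ge0// => i _; exact: sqr_ge0.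
  have VE : V <= K * k * E.
    have -> : K * k * E = n%:R^-1 * (q%:R * (K * E)) by rewrite /k; ring.
    rewrite ler_wpM2l//; apply: (@le_trans _ _ (#|S.1|%:R * (K * E))); last first.
      by rewrite ler_wpM2r ?mulr_ge0// ler_nat.
    rewrite (bigID (mem S.1))/= [X in _ + X]big1 ?addr0; last first.
      by move=> i iS; rewrite /a (negPf iS) mul0r expr0n.
    rewrite mulr_natl -sumr_const; apply: ler_sum => i iS.
    by rewrite /a iS mul1r; exact: Kb.
  have Z2 : Z <= 2 * ((m1 + m2) ^+ 2 + n%:R^-1 * \sum_(i < n) e i ^+ 2).
    have -> : (m1 + m2) ^+ 2 = n%:R^-1 * \sum_(i < n) (m1 + m2) ^+ 2.
      by rewrite sumr_const card_ord -[X in _ * X]mulr_natl mulKf// gt_eqF.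
    rewrite -mulrDr mulrCA ler_wpM2l// -big_split mulr_sumr; apply: ler_sum => i _ /=.
    rewrite /z; case: ifPn => iS; last first.
      by rewrite expr0n/= mulr_ge0// addr_ge0// sqr_ge0.
    have := Sm2 _ iS; have := fm1 _ (x_Om i); rewrite !ler_norml => /andP[? ?] /andP[? ?].
    have bnd : 0 <= (m1 + m2 - (S.2 i - f (x i))) * (m1 + m2 + (S.2 i - f (x i))).
      by apply: mulr_ge0; lra.
    have := sqr_ge0 (S.2 i - f (x i) + e i); lra.
  have kk0 : 0 <= K * k by rewrite mulr_ge0.
  have ZV : Z * V <= Z * (K * k * E) by rewrite ler_wpM2l.
  (* From T^2 <= b E follows (E / 4 + 16 b)^2 = (E / 4 - 16 b)^2 + 16 b E >= (4 T)^2. *)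
  have T4 : 4 * (n%:R^-1 * \sum_(i < n) z i * v (x i)) <= E / 4 + 16 * (K * k * Z).
    set T := n%:R^-1 * _ in CS *; set b := K * k * Z.
    have b0 : 0 <= b by rewrite mulr_ge0.
    have : T ^+ 2 <= b * E by apply: le_trans CS (le_trans ZV _); rewrite /b; lra.
    move=> TbE; have := sqr_ge0 (E / 4 - 16 * b).
    have [//|lt] := leP (4 * T) (E / 4 + 16 * b).
    have : (E / 4 + 16 * b) ^+ 2 < (4 * T) ^+ 2.
      by rewrite ltr_pXn2r// ?nnegrE; lra.
    lra.
  apply: le_trans T4 _; rewrite lerD2l -/k.
  have := ler_wpM2l kk0 Z2; lra.
have E1 : \sum_(i < n) (e i + z i) * v (x i) =
  \sum_(i < n) e i * v (x i) + \sum_(i < n) z i * v (x i).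
  by rewrite -big_split; apply: eq_bigr => i _; rewrite mulrDl.
(* Noise and corruption together take up E / 2, so solving for E doubles the constants 16, 32 and
   4. *)
rewrite E1 in H; lra.
Qed.

End Oracle.

(** * Geometry of the design and the sup bound by the energy *)

Section Design.
Variable R : realType.
Notation Om := (Omega R).

Lemma Delta_min_le n (x : 'I_n -> R) i j : i != j -> Delta_min x <= `|x i - x j|.
Proof.
move=> ij; apply: ge_inf; last by exists (i, j).
by exists 0 => _ [? _ <-].
Qed.

Lemma le_Delta_max n (x : 'I_n -> R) t : (0 < n)%N -> (forall i, Om (x i)) -> Om t ->
  inf [set `|t - x i| | i in [set: 'I_n]] <= Delta_max x.
Proof.
move=> n0 xO Ot; apply: ub_le_sup; last by exists t.
exists 1 => _ [s Os <-]; apply: le_trans (_ : `|s - x (Ordinal n0)| <= 1).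
  by apply: ge_inf; [exists 0 => _ [? _ <-]|exists (Ordinal n0)].
have := xO (Ordinal n0); move: Os; rewrite !OmegaE => /andP[? ?] /andP[? ?].
by rewrite ler_norml; apply/andP; split; lra.
Qed.

(** Pigeonhole: a half-open cell of length [r] holds at most one point, and truncn (1 / r) + 1 cells
    cover [0, 1]. *)
Lemma separated_card n (x : 'I_n -> R) (r : R) : (forall i, Om (x i)) -> 0 < r ->
  (forall i j, i != j -> r <= `|x i - x j|) -> n%:R * r <= 1 + r.
Proof.
move=> xO r0 sep.
have pos i : 0 <= x i / r.
  by have := xO i; rewrite OmegaE => /andP[? _]; rewrite divr_ge0// ltW.
have bnd i : (Num.truncn (x i / r) < (Num.truncn (1 / r)).+1)%N.
  rewrite ltnS le_truncn// ler_wpM2r ?invr_ge0 ?(ltW r0)//.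
  by have := xO i; rewrite OmegaE => /andP[].
pose b i : 'I_(Num.truncn (1 / r)).+1 := Ordinal (bnd i).
have binj : injective b.
  move=> i j /(congr1 val)/= e; apply/eqP; apply/negPn/negP => /sep;
    rewrite leNgt => /negP; apply.
  have /andP[a1 a2] := truncn_itv (pos i); have /andP[b1 b2] := truncn_itv (pos j).
  move: a1 a2; rewrite e => a1 a2.
  have rn0 : r != 0 by rewrite gt_eqF.
  rewrite -[x i](divfK rn0) -[x j](divfK rn0) -mulrBl normrM (gtr0_norm r0) gtr_pMl//.
  move: b1 b2 a1 a2; rewrite -natr1; set u := _%:R => *.
  by rewrite ltr_norml; apply/andP; split; lra.
have := leq_card b binj; rewrite !card_ord -(ler_nat R) -natr1 => nle.
have : (Num.truncn (1 / r))%:R <= 1 / r by rewrite truncn_le divr_ge0// ltW.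
move=> le1; apply: le_trans (_ : (1 / r + 1) * r <= _).
  by rewrite ler_wpM2r ?(ltW r0)//; lra.
by rewrite mulrDl divfK ?gt_eqF//; lra.
Qed.

(** Separation gives n Delta_min <= 2, hence Delta_max <= 2 k / n. The factor 3 makes the bound
    strict, so that the infimum yields a design point. *)
Lemma quasi_uniform_dense (x : forall n, 'I_n -> R) :
  (forall n i, Om (x n i)) -> quasi_uniform_design x ->
  exists2 k : R, 0 < k & forall n, (2 <= n)%N ->
    (exists i j, x n i != x n j) /\
    forall t, Om t -> exists i, `|t - x n i| < k / n%:R.
Proof.
move=> xO [k [k0 kP]]; exists (3 * k); first by rewrite mulr_gt0.
move=> n n2; have [m0 mk] := kP n n2.
have n0 : (0 < n)%N by exact: ltn_trans n2.
have n0' : 2 <= n%:R :> R by rewrite ler_nat.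
have sep i j : i != j -> Delta_min (x n) <= `|x n i - x n j| by exact: Delta_min_le.
split.
  exists (Ordinal n0), (Ordinal n2); rewrite -subr_eq0 -normr_gt0.
  by apply: lt_le_trans m0 _; apply: sep.
move=> t Ot; have := separated_card (xO n) m0 sep.
move: mk; rewrite ler_pdivrMr// => mk sc.
have H : inf [set `|t - x n i| | i in [set: 'I_n]] < 3 * k / n%:R.
  apply: le_lt_trans (le_Delta_max n0 (xO n) Ot) _; apply: le_lt_trans mk _.
  rewrite -mulrA mulrCA ltr_pM2l// ltr_pdivlMr; last lra.
  set m := Delta_min _ in sc m0 *.
  have : n%:R * m <= 2 by nra.
  lra.
have [|_ [i _ <-] ?] := inf_lt _ H; last by exists i.
by exists `|t - x n (Ordinal n0)|; exists (Ordinal n0).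
Qed.

(** Among [m] distinct design points in the window, one has a squared value at most the sum divided
    by [m]. Rounding down loses at most a factor 2, so m >= l / (6 r). *)
Lemma dense_third_value n (x : 'I_n -> R) (r a l : R) (v : R -> R) : 0 < r ->
  (forall t, Om t -> exists i, `|t - x i| < r) ->
  0 <= a -> a + l <= 1 -> 3 * r <= l ->
  exists s, [/\ a <= s, s <= a + l &
    v s ^+ 2 <= 6 * r / l * \sum_(i < n) v (x i) ^+ 2].
Proof.
move=> r0 dense a0 al rl.
have l0 : 0 < l by lra.
pose m := Num.truncn (l / (3 * r)).
have lr0 : 0 <= l / (3 * r) by rewrite divr_ge0; lra.
have /andP[m1 m2] := truncn_itv lr0; rewrite -/m in m1 m2.
have m_gt0 : (0 < m)%N by rewrite truncn_gt0 ler_pdivlMr; lra.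
have ml : m%:R * (3 * r) <= l by rewrite -ler_pdivlMr; lra.
have lm : l < (m%:R + 1) * (3 * r) by rewrite -ltr_pdivrMr ?natr1; lra.
have m1' : 1 <= m%:R :> R by rewrite ler1n.
(* Centres 3 r apart keep the chosen design points distinct, and the offset [r] keeps them inside
   the window. *)
pose T (k : 'I_m) := a + r + 3 * r * k%:R.
have kb (k : 'I_m) : (k%:R + 1 : R) <= m%:R by rewrite natr1 ler_nat.
have k0 (k : 'I_m) : 0 <= k%:R :> R by [].
have near_T (k : 'I_m) : exists i, `|T k - x i| < r.
  apply: dense; rewrite OmegaE /T; have := kb k; have := k0 k => p1 p2.
  by apply/andP; split; nra.
have [I HI] := choice near_T.
have Iin (k : 'I_m) : a <= x (I k) <= a + l.
  have := HI k; rewrite ltr_norml /T => /andP[? ?]; have := kb k; have := k0 k => p1 p2.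
  by apply/andP; split; nra.
have Iinj : injective I.
  move=> j k e; have := HI j; have := HI k; rewrite e !ltr_norml /T => /andP[? ?] /andP[? ?].
  apply/val_inj/eqP; rewrite eqn_leq; apply/andP; split; rewrite -ltnS -(ltr_nat R) -natr1;
  rewrite -(ltr_pM2l r0); lra.
have S0 : \sum_(k < m) v (x (I k)) ^+ 2 <= \sum_(i < n) v (x i) ^+ 2.
  rewrite (eq_bigl (mem [set: 'I_m]%SET)); last by move=> k; rewrite /= inE.
  rewrite -(big_imset (fun i => v (x i) ^+ 2) (in2W Iinj)).
  rewrite [leRHS](bigID (mem (I @: [set: 'I_m]%SET)))/= lerDl.
  by apply: sumr_ge0 => i _; exact: sqr_ge0.
have [k Hk] : exists k : 'I_m, m%:R * v (x (I k)) ^+ 2 <= \sum_(i < n) v (x i) ^+ 2.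
  apply: contrapT => /forallNP H.
  have : \sum_(k < m) \sum_(i < n) v (x i) ^+ 2 < \sum_(k < m) m%:R * v (x (I k)) ^+ 2.
    apply: ltr_sum; first by apply/hasP; exists (Ordinal m_gt0); rewrite ?mem_index_enum.
    by move=> k _; rewrite ltNge; apply/negP/H.
  rewrite -mulr_sumr sumr_const card_ord -[X in X < _]mulr_natl ltr_pM2l ?ltr0n//
    ltNge => /negP; exact.
exists (x (I k)); have /andP[-> ->] := Iin k; split=> //.
set D := \sum_(i < n) _ in Hk *; have q0 := sqr_ge0 (v (x (I k))).
have : l * v (x (I k)) ^+ 2 <= 6 * r * D.
  have D0 : 0 <= D by apply: sumr_ge0 => i _; exact: sqr_ge0.
  apply: le_trans (_ : 2 * m%:R * (3 * r) * v (x (I k)) ^+ 2 <= _).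
    by rewrite ler_wpM2r//; nra.
  have -> : 2 * m%:R * (3 * r) * v (x (I k)) ^+ 2 = 6 * r * (m%:R * v (x (I k)) ^+ 2) by ring.
  by rewrite ler_wpM2l//; lra.
by move=> H; rewrite mulrAC ler_pdivlMr// mulrC.
Qed.

(** Small values are found in the first and the last third of a window of length [h] containing [t],
    hence at least h / 3 apart; 9 k <= h n makes each third long enough to hold design points. *)
Lemma sup_energy_bound n (x : 'I_n -> R) (lam h k : R) v t :
  0 < h -> h <= 1 -> lam = h ^+ 4 -> (0 < n)%N -> 0 < k -> 9 * k <= h * n%:R ->
  (forall t, Om t -> exists i, `|t - x i| < k / n%:R) ->
  W2 v -> Om t -> v t ^+ 2 <= (2304 * k + 8) / h * energy lam x v v.
Proof.
move=> h0 h1 -> n0 k0 kh dense Wv Ot.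
have n0' : 0 < n%:R :> R by rewrite ltr0n.
have [v1 [_ v01 v12]] := second_derivP Wv.
have [a [a0 ah at_]] : exists a, [/\ 0 <= a, a + h <= 1 & a <= t <= a + h].
  move: Ot; rewrite OmegaE => /andP[t0 t1].
  have [th|th] := leP (t + h) 1; first by exists t; split=> //; apply/andP; split; lra.
  by exists (1 - h); split; [lra|lra|apply/andP; split; lra].
have r0 : 0 < k / n%:R by rewrite divr_gt0.
have rl : 3 * (k / n%:R) <= h / 3 by rewrite mulrA ler_pdivrMr//; lra.
have ah3 : a + h / 3 <= 1 by lra.
have a20 : 0 <= a + 2 * h / 3 by lra.
have ah3' : a + 2 * h / 3 + h / 3 <= 1 by lra.
have [s1 [as1 sa1 vs1]] := dense_third_value v r0 dense a0 ah3 rl.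
have [s2 [as2 sa2 vs2]] := dense_third_value v r0 dense a20 ah3' rl.
set D := \sum_(i < n) _ in vs1 vs2.
have D0 : 0 <= D by apply: sumr_ge0 => i _; exact: sqr_ge0.
set N := ip (second_deriv v) (second_deriv v).
have hab : a < a + h by lra.
have b1 : a <= s1 <= a + h by apply/andP; split; lra.
have b2 : a <= s2 <= a + h by apply/andP; split; lra.
have hh : a + h - a = h by ring.
have := sobolev_two_points v01 v12 a0 hab ah b1 b2 at_.
rewrite hh => /(_ _)/wrap[]; first by rewrite ger0_norm; lra.
set z := Num.sqrt h * _.
have z2 : z ^+ 2 = h * N by rewrite /z exprMn sqr_sqrtr ?(ltW h0)// sqr_L2norm.
have z0 : 0 <= z by rewrite mulr_ge0 ?sqrtr_ge0 ?L2norm_ge0.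
move=> vt.
have -> : energy (h ^+ 4) x v v = n%:R^-1 * D + h ^+ 4 * N.
  by rewrite /energy; congr (_ * _ + _); apply: eq_bigr => i _; rewrite expr2.
have e1 : 6 * (k / n%:R) / (h / 3) * D = 18 * k / h * (n%:R^-1 * D).
  by field; rewrite !gt_eqF.
rewrite e1 in vs1 vs2.
set d := n%:R^-1 * D in vs1 vs2 *.
have d0 : 0 <= d by rewrite mulr_ge0// invr_ge0 ltW.
(* Squaring gives the factors 64 and 8. Each of the two point values contributes 18 k / h, and 64 *
   36 = 2304. *)
have vt2 : v t ^+ 2 <= 64 * (v s1 ^+ 2 + v s2 ^+ 2) + 8 * (h ^+ 2 * z ^+ 2).
  have : `|v t| ^+ 2 <= (4 * (`|v s1| + `|v s2|) + 2 * (h * z)) ^+ 2.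
    by rewrite lerXn2r// nnegrE// addr_ge0// mulr_ge0// ?addr_ge0// mulr_ge0// ltW.
  rewrite -(real_normK (num_real (v t))) -(real_normK (num_real (v s1))) -(real_normK
    (num_real (v s2))).
  have := sqr_ge0 (`|v s1| - `|v s2|).
  have := sqr_ge0 (4 * (`|v s1| + `|v s2|) - 2 * (h * z)).
  lra.
apply: le_trans vt2 _; rewrite z2.
have -> : (2304 * k + 8) / h * (d + h ^+ 4 * N) =
  2304 * k / h * d + 8 / h * d + 2304 * k * (h ^+ 3 * N) + 8 * (h ^+ 3 * N).
  by field; rewrite gt_eqF.
have N0 : 0 <= N by exact: ip_ge0.
have : 0 <= 8 / h * d by rewrite mulr_ge0// divr_ge0// ltW.
have hN : 0 <= h ^+ 3 * N by rewrite mulr_ge0// exprn_ge0// ltW.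
have k0' : 0 <= 2304 * k by lra.
have := mulr_ge0 k0' hN.
have -> : 8 * (h ^+ 2 * (h * N)) = 8 * (h ^+ 3 * N) by ring.
have -> : 2304 * k / h * d = 64 * (18 * k / h * d + 18 * k / h * d) by ring.
lra.
Qed.

End Design.

(** * Moments of the noise *)

Section Moments.
Context (R : realType) (d : measure_display) (T : measurableType d).
Variable P : probability T R.

Lemma centered_second_moment (X : {RV P >-> R}) (s : R) :
  'E_P[X]%E = 0%E -> ('V_P[X] <= s%:E)%E -> (\int[P]_w (X w ^+ 2)%:E <= s%:E)%E.
Proof.
move=> EX VX; apply: le_trans VX; rewrite /variance covariance.unlock EX expectation.unlock.
by rewrite le_eqVlt; apply/orP; left; apply/eqP; apply: eq_integral => w _ /=;
  rewrite /GRing.mul/= subr0 expr2.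
Qed.

Lemma integrable_sqr_RV (X : {RV P >-> R}) (s : R) :
  (\int[P]_w (X w ^+ 2)%:E <= s%:E)%E -> P.-integrable setT (fun w => (X w ^+ 2)%:E).
Proof.
move=> Xs; apply/integrableP; split.
  by apply/measurable_EFinP; exact: measurable_funX.
apply: le_lt_trans (ltry s); apply: le_trans Xs.
by rewrite le_eqVlt; apply/orP; left; apply/eqP; apply: eq_integral => w _ /=;
  rewrite ger0_norm ?sqr_ge0.
Qed.

Lemma integrable_mul_RV (X Y : {RV P >-> R}) :
  P.-integrable setT (fun w => (X w ^+ 2)%:E) -> P.-integrable setT (fun w => (Y w ^+ 2)%:E) ->
  P.-integrable setT (fun w => (X w * Y w)%:E).
Proof.
move=> iX iY; apply: le_integrable (integrableD _ iX iY) => //.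
  by apply/measurable_EFinP; exact: measurable_funM.
move=> w _ /=; rewrite lee_fin [leRHS]ger0_norm ?addr_ge0 ?sqr_ge0// ler_norml.
have := sqr_ge0 (X w + Y w); have := sqr_ge0 (X w - Y w).
have := sqr_ge0 (X w); have := sqr_ge0 (Y w).
by move=> ? ? ? ?; apply/andP; split; nra.
Qed.

Variables X Y : {RV P >-> R}.

Definition pair_RV (w : T) : R * R := (X w, Y w).

Let measurable_pair_RV : measurable_fun setT pair_RV.
Proof. by apply: measurable_fun_pair. Qed.

HB.instance Definition _ := isMeasurableFun.Build _ _ _ _ pair_RV measurable_pair_RV.

(* The joint law of [X] and [Y] agrees with the product law on rectangles, hence
   everywhere, and Fubini factors the expectation of the product. *)
Lemma uncorrelated :
  (forall A B : set R, measurable A -> measurable B ->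
    P ((X @^-1` A) `&` (Y @^-1` B)) = (P (X @^-1` A) * P (Y @^-1` B))%E) ->
  P.-integrable setT (fun w => (X w ^+ 2)%:E) -> P.-integrable setT (fun w => (Y w ^+ 2)%:E) ->
  'E_P[Y]%E = 0%E -> (\int[P]_w (X w * Y w)%:E = 0)%E.
Proof.
move=> indep iX iY EY.
have iXY := integrable_mul_RV iX iY.
pose f (z : R * R) : \bar R := (z.1 * z.2)%:E.
have mf : measurable_fun setT f by apply/measurable_EFinP; exact: measurable_funM.
pose m1 := distribution P X; pose m2 := distribution P Y; pose m := distribution P pair_RV.
have mE A : measurable A -> (m1 \x m2)%E A = m A.
  by apply: product_measure_unique => // B C mB mC;
    rewrite /m/= /distribution/= /pushforward/= -indep.
have jointE : (\int[P]_w (X w * Y w)%:E = \int[m]_z f z)%E.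
  by rewrite integral_distribution.
have intm : m.-integrable setT f.
  by apply: integrable_pushforward.
have intmm : (m1 \x m2)%E.-integrable setT f.
  move/integrableP : intm => [_ im]; apply/integrableP; split=> //.
  by rewrite (eq_measure_integral m)// => A mA _; exact: mE.
have mYE x : (\int[m2]_y (x * y)%:E = 0)%E.
  under eq_integral do rewrite EFinM.
  have iY1 : P.-integrable setT (EFin \o Y).
    have i1 : P.-integrable setT (EFin \o cst (1 : R)) by exact: finite_measure_integrable_cst.
    apply: le_integrable (integrableD _ i1 iY) => //; first exact/measurable_EFinP.
    move=> w _ /=; rewrite lee_fin [leRHS]ger0_norm ?addr_ge0 ?sqr_ge0// ler_norml.
    have := sqr_ge0 (Y w - 1); have := sqr_ge0 (Y w + 1).
    by move=> ? ?; apply/andP; split; lra.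
  rewrite integralZl//; last by apply: integrable_pushforward.
  rewrite integral_distribution//.
  by move: EY; rewrite expectation.unlock => ->; rewrite mule0.
rewrite jointE.
have -> : (\int[m]_z f z = \int[m1 \x m2]_z f z)%E.
  by apply: eq_measure_integral => A mA _; apply/esym; exact: mE.
rewrite -(integral12_prod_meas1 intmm)//.
by apply: integral0_eq => x _; exact: mYE.
Qed.
End Moments.

Section QuadraticForm.
Context (R : realType) (d : measure_display) (T : measurableType d).
Variable P : probability T R.

Lemma iid_integrable_sqr sigma n (eps : 'I_n -> {RV P >-> R}) i : iid_noise sigma eps ->
  P.-integrable setT (fun w => (eps i w ^+ 2)%:E) /\
  (\int[P]_w (eps i w ^+ 2)%:E <= (sigma ^+ 2)%:E)%E.
Proof.
move=> [_ _ E0 V]; have H := centered_second_moment (E0 i) (V i).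
by split=> //; exact: integrable_sqr_RV H.
Qed.

Lemma iid_uncorrelated sigma n (eps : 'I_n -> {RV P >-> R}) i j : iid_noise sigma eps ->
  i != j -> (\int[P]_w (eps i w * eps j w)%:E = 0)%E.
Proof.
move=> N ij; have [indep _ E0 _] := N.
have [iX _] := iid_integrable_sqr i N; have [iY _] := iid_integrable_sqr j N.
apply: uncorrelated => // A B mA mB.
pose C k := if k == i then A else B.
have mC k : measurable (C k) by rewrite /C; case: ifP.
have := indep [set i; j]%SET C mC; rewrite big_setU1 ?inE// big_set1 /C eqxx.
rewrite (eq_sym j i) (negPf ij) => <-; congr (P _).
apply/seteqP; split=> [w [Aw Bw] k|w H].
  rewrite /= !inE => /orP[] /eqP ->; rewrite ?eqxx//.
  by rewrite eq_sym (negPf ij).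
have := H i; have := H j; rewrite /= !inE !eqxx orbT (eq_sym j i)
  (negPf ij) => /(_ isT) ? /(_ isT) ?.
by split.
Qed.

(** Off-diagonal products have expectation zero; the diagonal needs a sign because the variances are
    bounded from above only. *)
Lemma quadratic_form_expectation sigma n (eps : 'I_n -> {RV P >-> R}) (a : 'I_n -> 'I_n -> R) :
  iid_noise sigma eps -> (forall i, 0 <= a i i) ->
  let F := fun w => \sum_(i < n) \sum_(j < n) a i j * (eps i w * eps j w) in
  P.-integrable setT (EFin \o F) /\
  (\int[P]_w (F w)%:E <= (sigma ^+ 2 * \sum_(i < n) a i i)%:E)%E.
Proof.
move=> N a0 F.
have iE i j : P.-integrable setT (fun w => ((a i j)%:E * (eps i w * eps j w)%:E)%E).
  apply: integrableZl => //.
  by apply: integrable_mul_RV; [exact: (iid_integrable_sqr i N).1|exact: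
    (iid_integrable_sqr j N).1].
have FE : EFin \o F = fun w => (\sum_(i < n) \sum_(j < n) ((a i j)%:E *
  (eps i w * eps j w)%:E))%E.
  apply/funext => w; rewrite /F /= -sumEFin; apply: eq_bigr => i _; rewrite -sumEFin.
  by apply: eq_bigr => j _; rewrite EFinM.
have iS i : P.-integrable setT (fun w => (\sum_(j < n) ((a i j)%:E *
  (eps i w * eps j w)%:E))%E).
  exact: integrable_sum.
split; first by rewrite FE; exact: integrable_sum.
have -> : (\int[P]_w (F w)%:E = \int[P]_w ((EFin \o F) w))%E by [].
rewrite FE integral_sum// mulr_sumr -sumEFin; apply: lee_sum => i _.
rewrite integral_sum// (bigD1 i)//= big1 ?adde0 => [|j ji].
  rewrite integralZl//; last first.
    by apply: integrable_mul_RV; exact: (iid_integrable_sqr i N).1.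
  rewrite mulrC EFinM lee_wpmul2l ?lee_fin//.
  by under eq_integral do rewrite -expr2; exact: (iid_integrable_sqr i N).2.
rewrite integralZl//; last first.
  by apply: integrable_mul_RV; [exact: (iid_integrable_sqr i N).1|exact:
    (iid_integrable_sqr j N).1].
by rewrite (iid_uncorrelated N) ?mule0// eq_sym.
Qed.

End QuadraticForm.

(** * Losses and risks *)

Section Loss.
Variable R : realType.
Notation mu := (@lebesgue_measure R).
Notation Om := (Omega R).
Implicit Types f g : R -> R.

Lemma poweR_sqr (x : \bar R) : (0 <= x)%E -> (x `^ 2 = x ^+ 2)%E.
Proof.
case: x => [r r0||//]; first by rewrite poweR_EFin powR_mulrn// EFin_expe.
by rewrite poweRyr ?pnatr_eq0// expe2 mulyy.
Qed.

Lemma integral_Omega_cst (B : R) : (\int[mu]_(t in Om) B%:E = B%:E)%E.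
Proof.
transitivity (B%:E * mu Om)%E; last by rewrite measure_Omega mule1.
by apply: integral_cst; exact: measurable_Omega.
Qed.

Lemma measure_setT_gt0 : (0 < mu setT)%E.
Proof.
apply: lt_le_trans (_ : mu Om <= _)%E; first by rewrite measure_Omega lte_fin.
by apply: le_measure => //; rewrite inE//; exact: measurable_Omega.
Qed.

Let res f g := (fun t => f t - g t) \_ Om.

Lemma sq_loss2E f g :
  sq_loss 2%:E f g = (\int[mu]_(t in Om) ((f t - g t) ^+ 2)%:E)%E.
Proof.
rewrite /sq_loss -poweR_sqr ?Lnorm_ge0// poweR_Lnorm ?pnatr_eq0//.
rewrite [RHS]integral_mkcond; apply: eq_integral => t _.
rewrite /= !patchE; case: ifPn => _.
  by rewrite powR_mulrn// -normrX ger0_norm// sqr_ge0.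
by rewrite normr0 powR0// pnatr_eq0.
Qed.

Lemma sq_lossyE f g :
  sq_loss +oo%E f g = ((ess_sup mu (fun t => `|res f g t|%:E)) ^+ 2)%E.
Proof. by rewrite /sq_loss unlock measure_setT_gt0. Qed.

(** One pointwise bound serves both losses, because [0, 1] has measure 1. *)
Lemma sq_loss_le (p : \bar R) f g (B : R) : p = 2%:E \/ p = +oo%E ->
  measurable_fun Om f -> measurable_fun Om g -> 0 <= B ->
  (forall t, Om t -> (f t - g t) ^+ 2 <= B) -> (sq_loss p f g <= B%:E)%E.
Proof.
have mO := @measurable_Omega R.
move=> [->|->] mf mg B0 H.
  rewrite sq_loss2E.
  rewrite -[B%:E]integral_Omega_cst.
  apply: ge0_le_integral => //=.
  - by move=> t _; rewrite lee_fin sqr_ge0.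
  - by apply/measurable_EFinP; apply: measurable_funX; exact: measurable_funB.
rewrite sq_lossyE -[B](sqr_sqrtr B0) EFin_expe lee_sqr ?lee_fin ?sqrtr_ge0//; last first.
  by apply: ess_sup_gee measure_setT_gt0 _; apply: nearW => t; rewrite lee_fin.
apply/ess_supP; apply: nearW => t; rewrite lee_fin /res patchE; case: ifPn => [/set_mem Ot|_].
  by rewrite -sqrtr_sqr ler_wsqrtr// H.
by rewrite normr0 sqrtr_ge0.
Qed.

Lemma sq_loss_ge0 p f g : (0 <= sq_loss p f g)%E.
Proof. exact: sqre_ge0. Qed.

Lemma sq_loss_2y f g : measurable_fun Om f -> measurable_fun Om g ->
  (sq_loss 2%:E f g <= sq_loss +oo%E f g)%E.
Proof.
have mO := @measurable_Omega R.
move=> mf mg; rewrite sq_loss2E sq_lossyE.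
set M := ess_sup _ _.
have M0 : (0 <= M)%E by apply: ess_sup_gee measure_setT_gt0 _; apply: nearW => t;
  rewrite lee_fin.
have := ess_sup_ge mu (fun t => `|res f g t|%:E); rewrite -/M.
case: M M0 => [m m0 H||//]; last by move=> _ _; rewrite expe2 mulyy leey.
rewrite -EFin_expe; rewrite -[leRHS]integral_Omega_cst.
apply: ae_ge0_le_integral => //=.
- by move=> t _; rewrite lee_fin sqr_ge0.
- by apply/measurable_EFinP; apply: measurable_funX; exact: measurable_funB.
- by move=> t _; rewrite lee_fin sqr_ge0.
- apply: filterS H => t; rewrite lee_fin /res patchE => H Ot; rewrite mem_set// in H.
  by rewrite lee_fin -(real_normK (num_real _)) ler_pXn2r// nnegrE.
Qed.
End Loss.

Section Risk.
Context (R : realType) (d : measure_display) (T : measurableType d).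
Variable P : probability T R.
Notation Om := (Omega R).

Lemma W2_measurable (g : R -> R) : W2 g -> measurable_fun Om g.
Proof. by move=> [? [? [[]]]]. Qed.

Lemma spline_measurable (lam : nat -> R) : measurable_estimator (spline_estimator lam).
Proof.
move=> n x y; rewrite /spline_estimator /smoothing_spline; case: xgetP => [g -> [Wg _]|_].
  exact: W2_measurable.
exact: measurable_cst.
Qed.

(** The strategy that corrupts nothing is always allowed, which rules out the supremum of an empty
    set, equal to -oo. *)
Lemma worst_loss_ge0 p q m2 f (est : estimator R) n (x e : 'I_n -> R) :
  (0 <= worst_loss p q m2 f est x e)%E.
Proof.
pose S0 : {set 'I_n} * ('I_n -> R) := (finset.set0, fun=> 0).
apply: (le_trans (y := sq_loss p f (est n x (observed f x e S0)))); first exact: sq_loss_ge0.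
apply: ereal_sup_ubound; exists S0 => //=.
by split; [rewrite cards0|move=> i; rewrite inE].
Qed.

Lemma upper_expectation_ge0 (h : T -> \bar R) : (forall w, 0 <= h w)%E ->
  (0 <= upper_expectation P h)%E.
Proof.
move=> h0; apply: le_ereal_inf_tmp => _ [g [mg hg] <-].
by apply: integral_ge0 => w _; exact: le_trans (hg w).
Qed.

Lemma risk_ge0 p eps x m2 q f (est : estimator R) n :
  (0 <= risk (P := P) p eps x m2 q f est n)%E.
Proof. by apply: upper_expectation_ge0 => w; exact: worst_loss_ge0. Qed.

(* The dominating function is a quadratic form in the noise, so only its diagonal
   contributes to the expectation. *)
Lemma spline_risk_le p (eps : forall n, 'I_n -> {RV P >-> R}) (x : forall n, 'I_n -> R)
    (m1 m2 sigma : R) (q : nat -> nat) f (lam : nat -> R) n (K : R) :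
  p = 2%:E \/ p = +oo%E -> 0 <= m1 -> 0 <= m2 -> iid_noise sigma (eps n) ->
  (forall i, Om (x n i)) -> (0 < n)%N -> (exists i j, x n i != x n j) -> 0 < lam n ->
  0 <= K -> (forall v, W2 v -> forall t, Om t -> v t ^+ 2 <= K * energy (lam n) (x n) v v) ->
  admissible m1 f ->
  (risk p eps x m2 q f (spline_estimator lam) n <=
   (K * (32 * (sigma ^+ 2 * (K / n%:R))
         + 64 * (K * ((q n)%:R / n%:R)) * ((m1 + m2) ^+ 2 + sigma ^+ 2)
         + 8 * lam n * ip (second_deriv f) (second_deriv f)))%:E)%E.
Proof.
move=> hp m10 m20 N xO n0 xd lam0 K0 Kb admf; have [Wf _] := admf.
have nR : 0 < n%:R :> R by rewrite ltr0n.
have [U HU] := unit_representers lam0 n0 xO xd.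
have WU j : W2 (U j) by case: (HU j).
have UE j v : W2 v -> energy (lam n) (x n) (U j) v = n%:R^-1 * v (x n j) by move=> Wv;
  exact: (HU j).2.
pose kap := K * ((q n)%:R / n%:R).
have kap0 : 0 <= kap by rewrite mulr_ge0// divr_ge0.
pose I0 := ip (second_deriv f) (second_deriv f).
(* The mean square of the noise is folded into the diagonal, so that the whole majorant is a
   constant plus one quadratic form. *)
pose a i j := 32 * K * n%:R^-1 * U j (x n i) + (i == j)%:R * (64 * K * kap * n%:R^-1).
pose c0 := K * (64 * kap * (m1 + m2) ^+ 2 + 8 * lam n * I0).
have Uii i : 0 <= n%:R^-1 * U i (x n i) by rewrite -UE//; exact: energy_ge0.
have aii i : 0 <= a i i.
  rewrite /a eqxx mul1r addr_ge0//; first by rewrite -!mulrA mulr_ge0// mulr_ge0.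
  by rewrite !mulr_ge0// invr_ge0 ltW.
pose F w := \sum_(i < n) \sum_(j < n) a i j * (eps n i w * eps n j w).
have [iF FE] : P.-integrable setT (EFin \o F) /\
    (\int[P]_w (F w)%:E <= (sigma ^+ 2 * \sum_(i < n) a i i)%:E)%E.
  exact: quadratic_form_expectation.
have BE w : K * (32 * noise_energy (x n) U (fun i => eps n i w)
    + 64 * kap * ((m1 + m2) ^+ 2 + n%:R^-1 * \sum_(i < n) eps n i w ^+ 2)
    + 8 * lam n * I0) = c0 + F w.
  have -> : F w = 32 * K * noise_energy (x n) U (fun i => eps n i w) +
      64 * K * kap * (n%:R^-1 * \sum_(i < n) eps n i w ^+ 2).
    rewrite /noise_energy !mulr_sumr -big_split/=; apply: eq_bigr => i _.
    have -> : 64 * K * kap * (n%:R^-1 * eps n i w ^+ 2) =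
        \sum_(j < n) (i == j)%:R * (64 * K * kap * n%:R^-1) * (eps n i w * eps n j w).
      rewrite (bigD1 i)//= eqxx mul1r big1 ?addr0; first by ring.
      by move=> j; rewrite eq_sym => /negPf ->; rewrite !mul0r.
    rewrite mulr_sumr mulr_sumr -big_split/=; apply: eq_bigr => j _; rewrite /a; ring.
  by rewrite /c0; ring.
have mF : measurable_fun setT F by apply/measurable_EFinP; exact: measurable_int iF.
apply: le_trans (_ : (\int[P]_w (c0 + F w)%:E <= _)%E).
  apply: ereal_inf_lbound; exists (fun w => (c0 + F w)%:E) => //; split.
    by apply/measurable_EFinP; exact: measurable_funD.
  move=> w; apply: ge_ereal_sup => _ [S hS <-].
  have bnd t : Om t -> (f t - spline_estimator lam (x n)
      (observed f (x n) (fun i => eps n i w) S) t) ^+ 2 <= c0 + F w.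
    by move=> Ot; rewrite -BE; exact: (oracle_sup_bound lam0 n0 xO xd WU UE K0 Kb).
  apply: sq_loss_le => //.
  - exact: W2_measurable.
  - exact: spline_measurable.
  - by apply: le_trans (sqr_ge0 _) (bnd 0 _); rewrite OmegaE lexx ler01.
have ic : P.-integrable setT (EFin \o cst c0) by exact: finite_measure_integrable_cst.
have -> : (\int[P]_w (c0 + F w)%:E = c0%:E + \int[P]_w (F w)%:E)%E.
  transitivity (\int[P]_w c0%:E + \int[P]_w (F w)%:E)%E; first by apply: integralD_EFin.
  congr (_ + _)%E.
  transitivity (c0%:E * P setT)%E; last by rewrite probability_setT mule1.
  exact: integral_cst.
apply: le_trans (leeD (lexx _) FE) _.
rewrite -EFinD lee_fin.
have Sa : \sum_(i < n) a i i <= 32 * K * (K / n%:R) + 64 * K * kap.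
  have -> : 32 * K * (K / n%:R) + 64 * K * kap =
      \sum_(i < n) (32 * K * n%:R^-1 * (K / n%:R) + 64 * K * kap * n%:R^-1).
    by rewrite sumr_const card_ord -[RHS]mulr_natl; field; rewrite gt_eqF.
  apply: ler_sum => i _; rewrite /a eqxx mul1r lerD2r ler_wpM2l//.
    by rewrite !mulr_ge0// invr_ge0 ltW.
  exact: (representer_diag xO WU UE K0 Kb).
have := ler_wpM2l (sqr_ge0 sigma) Sa.
rewrite -/kap -/I0 /c0; lra.
Qed.
End Risk.

(** * Choice of the smoothing parameter *)

Section Limits.
Variable R : realType.

Lemma cvg_powR0 (t : nat -> R) (c : R) : (forall n, 0 <= t n) -> 0 < c ->
  t n @[n --> \oo] --> 0 -> t n `^ c @[n --> \oo] --> 0.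
Proof.
move=> t0 c0 tc; apply/cvgr0Pnorm_le => e e0.
have d0 : 0 < e `^ c^-1 by rewrite powR_gt0.
move/cvgr0Pnorm_le : tc => /(_ _ d0); apply: filterS => n.
rewrite (ger0_norm (t0 n)) ger0_norm ?powR_ge0// => tn.
have -> : e = (e `^ c^-1) `^ c by rewrite -powRrM mulVf ?gt_eqF// powRr1// ltW.
by apply: ge0_ler_powR => //; rewrite ?nnegrE ?(ltW d0)// ltW.
Qed.

(** Both prescribed choices of lambda have this form, with (al, be) equal to (2/5, 4/3) and (1/2,
    6/5). *)
Definition lambda_rate (al be : R) (q : nat -> nat) (n : nat) : R :=
  if n%:R `^ al <= (q n)%:R then ((q n)%:R / n%:R) `^ be else n%:R `^ (- (4 / 5)).

(* With [u = 1/n] and [theta = q/n], the switch in [lambda_rate] is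
   [u^(1-al) <= theta]. *)
Lemma lambda_rate_bounds (al be : R) q n :
  0 <= al -> al < 3 / 5 -> 0 < be -> be < 2 -> (0 < n)%N -> (q n < n)%N ->
  let u : R := n%:R^-1 in let th : R := (q n)%:R / n%:R in
  exists h : R, [/\ 0 < h, h <= 1, lambda_rate al be q n = h ^+ 4 &
    [/\ h <= th `^ (be / 4) + u `^ (1 / 5),
    th / h ^+ 2 <= th `^ (1 - be / 2) + u `^ (3 / 5 - al)
    & u / h ^+ 2 <= u `^ (1 - be / 2) + u `^ (3 / 5)]].
Proof.
move=> al0 al1 be0 be1 n0 qn u th.
have nR : 0 < n%:R :> R by rewrite ltr0n.
have u0 : 0 < u by rewrite invr_gt0.
have u1 : u <= 1 by rewrite invf_le1// ler1n.
have th0 : 0 <= th by rewrite divr_ge0.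
have th1 : th <= 1 by rewrite ler_pdivrMr// mul1r ler_nat ltnW.
have powD (x r s : R) : 0 < x -> x `^ (r + s) = x `^ r * x `^ s.
  by move=> x0; rewrite powRD // (gt_eqF x0) implybT.
have p1 (r : R) : (1 : R) `^ r = 1 by rewrite powR1.
have nu (r : R) : n%:R `^ r = u `^ (- r).
  have -> : u = n%:R `^ (-1) by rewrite powR_inv1// ltW.
  by rewrite -powRrM; congr powR; ring.
have nal : (n%:R `^ al <= (q n)%:R) = (u `^ (1 - al) <= th).
  by rewrite powD// powRr1 ?(ltW u0)// -nu mulrC /th ler_pM2r.
rewrite /lambda_rate nal; case: leP => H.
  have thp : 0 < th by apply: lt_le_trans H; rewrite powR_gt0.
  exists (th `^ (be / 4)); have h0 : 0 < th `^ (be / 4) by rewrite powR_gt0.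
  have h2 : th `^ (be / 4) ^+ 2 = th `^ (be / 2).
    by rewrite -powR_mulrn ?powR_ge0// -powRrM; congr powR; field.
  split=> //; last split.
  - by rewrite -[leRHS](p1 (be / 4)); apply: ge0_ler_powR; rewrite ?nnegrE//; lra.
  - by rewrite -powR_mulrn ?powR_ge0// -powRrM; congr powR; field.
  - by rewrite lerDl powR_ge0.
  - by rewrite h2 powD// powRr1// powRN lerDl powR_ge0.
  (* Above the switch u <= u^(1 - al) <= th, so th^(be / 2) may be replaced by u^(be / 2) in the
     denominator. *)
  - rewrite h2; apply: le_trans (_ : u `^ (1 - be / 2) <= _); last by rewrite lerDl powR_ge0.
    rewrite powD// powRr1 ?(ltW u0)// powRN ler_wpM2l ?(ltW u0)//.
    rewrite lef_pV2 ?posrE ?powR_gt0//.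
    apply: ge0_ler_powR; rewrite ?nnegrE//; [lra|exact: ltW|].
    by apply: le_trans H; apply: ger1_powR; rewrite ?u0//; lra.
exists (u `^ (1 / 5)); have h0 : 0 < u `^ (1 / 5) by rewrite powR_gt0.
have h2 : u `^ (1 / 5) ^+ 2 = u `^ (2 / 5).
  by rewrite -powR_mulrn ?powR_ge0// -powRrM; congr powR; field.
split=> //; last split.
- by rewrite -[leRHS](p1 (1 / 5)); apply: ge0_ler_powR; rewrite ?nnegrE ?(ltW u0)//; lra.
- rewrite nu opprK -powR_mulrn ?powR_ge0// -powRrM; congr powR; lra.
- by rewrite lerDr powR_ge0.
(* Below the switch th <= u^(1 - al), while h^2 = u^(2/5). *)
- rewrite h2; apply: le_trans (_ : u `^ (3 / 5 - al) <= _); last by rewrite lerDr powR_ge0.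
  rewrite ler_pdivrMr ?powR_gt0// -powD//.
  by rewrite (_ : 3 / 5 - al + 2 / 5 = 1 - al); [exact: ltW|field].
- rewrite h2; apply: le_trans (_ : u `^ (3 / 5) <= _); last by rewrite lerDr powR_ge0.
  rewrite ler_pdivrMr ?powR_gt0// -powD//.
  by rewrite (_ : 3 / 5 + 2 / 5 = 1 :> R); [rewrite powRr1// ltW|field].
Qed.

Lemma littleo_ratio (q : nat -> nat) :
  (fun n : nat => (q n)%:R : R^o) =o_\oo (fun n : nat => n%:R : R^o) ->
  ((q n)%:R / n%:R : R) @[n --> \oo] --> (0 : R).
Proof.
move=> /eqoP qo; apply/cvgr0Pnorm_le => e e0; move: (qo _ e0);
  apply: filterS2 (nbhs_infty_gt 0).
move=> n n0; rewrite !normr_nat normrM normfV !normr_nat => H.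
by rewrite ler_pdivrMr// ltr0n.
Qed.

Lemma cvg_invn : (n%:R^-1 : R) @[n --> \oo] --> (0 : R).
Proof.
rewrite -(cvg_shiftS (fun n : nat => n%:R^-1 : R)); exact: cvg_harmonic.
Qed.

End Limits.

Section SplineConsistency.
Context (R : realType) (d : measure_display) (T : measurableType d).
Variable P : probability T R.
Notation Om := (Omega R).

(** The conditions al < 3/5 and 0 < be < 2 make every exponent positive in the bounds on h, th / h^2
    and u / h^2. *)
Lemma spline_risk_cvg p (eps : forall n, 'I_n -> {RV P >-> R}) (x : forall n, 'I_n -> R)
    (m1 m2 sigma al be : R) (q : nat -> nat) f :
  p = 2%:E \/ p = +oo%E -> 0 <= m1 -> 0 <= m2 -> (forall n, iid_noise sigma (eps n)) ->
  (forall n i, Om (x n i)) -> quasi_uniform_design x -> corruption_budget q ->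
  (fun n : nat => (q n)%:R : R^o) =o_\oo (fun n : nat => n%:R : R^o) ->
  0 <= al -> al < 3 / 5 -> 0 < be -> be < 2 -> admissible m1 f ->
  risk p eps x m2 q f (spline_estimator (lambda_rate al be q)) n @[n --> \oo] --> 0%E.
Proof.
move=> hp m10 m20 N xO xqu qb qo al0 al1 be0 be1 admf.
have [k k0 dense] := quasi_uniform_dense xO xqu.
pose u (n : nat) : R := n%:R^-1; pose th (n : nat) : R := (q n)%:R / n%:R.
have [C C0 CE] : exists2 C : R, 0 < C & C = 2304 * k + 8 by exists (2304 * k + 8);
  [lra|reflexivity].
pose B1 n := u n `^ (1 - be / 2) + u n `^ (3 / 5).
pose B2 n := th n `^ (1 - be / 2) + u n `^ (3 / 5 - al).
pose B3 n := th n `^ (be / 4) + u n `^ (1 / 5).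
pose I0 := ip (second_deriv f) (second_deriv f).
have u_cvg : u n @[n --> \oo] --> (0 : R) by exact: cvg_invn.
have th_cvg : th n @[n --> \oo] --> (0 : R) by exact: littleo_ratio.
have u0 n : 0 <= u n by rewrite invr_ge0.
have th0 n : 0 <= th n by rewrite divr_ge0.
have B1c : B1 n @[n --> \oo] --> (0 : R).
  by rewrite -[X in _ --> X]addr0; apply: cvgD; apply: cvg_powR0 => //; lra.
have B2c : B2 n @[n --> \oo] --> (0 : R).
  by rewrite -[X in _ --> X]addr0; apply: cvgD; apply: cvg_powR0 => //; lra.
have B3c : B3 n @[n --> \oo] --> (0 : R).
  by rewrite -[X in _ --> X]addr0; apply: cvgD; apply: cvg_powR0 => //; lra.
pose b n := 32 * sigma ^+ 2 * C ^+ 2 * B1 n + 64 * C ^+ 2 * ((m1 + m2) ^+ 2 + sigma ^+ 2) * B2 n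
  + 8 * C * I0 * B3 n.
have bc : b n @[n --> \oo] --> (0 : R).
  have -> : (0 : R) = 32 * sigma ^+ 2 * C ^+ 2 * 0
    + 64 * C ^+ 2 * ((m1 + m2) ^+ 2 + sigma ^+ 2) * 0 + 8 * C * I0 * 0 by rewrite !mulr0 !addr0.
  by apply: cvgD; [apply: cvgD|]; apply: cvgM => //; exact: cvg_cst.
have bce : (b n)%:E @[n --> \oo] --> 0%E by apply: cvg_EFin => //; exact: nearW.
apply: (squeeze_cvge _ (@cvg_cst _ 0%E _ _ _) bce).
(* The sup bound asks for 9 k <= h n. As u / h^2 tends to 0, eventually 9 k <= h^2 n, and h <= 1. *)
have B1e : \forall n \near \oo, B1 n <= (9 * k)^-1.
  have e0 : 0 < (9 * k)^-1 by rewrite invr_gt0; lra.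
  move/cvgr0Pnorm_le : B1c => /(_ _ e0); apply: filterS => n.
  by rewrite ger0_norm// addr_ge0// powR_ge0.
move: B1e; apply: filterS2 (nbhs_infty_ge 2) => n n2 B1n.
rewrite risk_ge0/=.
have n0 : (0 < n)%N by exact: leq_trans n2.
have nR : 0 < n%:R :> R by rewrite ltr0n.
have [h [h0 h1 lamE [h3 thh uh]]] := lambda_rate_bounds al0 al1 be0 be1 n0 (qb _ n0).
have [xd dn] := dense n n2.
have h20 : 0 < h ^+ 2 by rewrite exprn_gt0.
have kh : 9 * k <= h * n%:R.
  apply: le_trans (_ : h ^+ 2 * n%:R <= _); last by rewrite ler_pM2r// expr2 ler_piMl// ltW.
  have := le_trans uh B1n; rewrite ler_pdivrMr//
    -[X in _ <= X * _]/((9 * k)^-1) mulrC ler_pdivlMr; last lra.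
  by rewrite mulrC ler_pdivrMr.
have lam0 : 0 < lambda_rate al be q n by rewrite lamE exprn_gt0.
have K0 : 0 <= C / h by rewrite divr_ge0// ltW.
have Kb v : W2 v -> forall t, Om t ->
  v t ^+ 2 <= C / h * energy (lambda_rate al be q n) (x n) v v.
  by move=> Wv t Ot; rewrite CE; apply: (sup_energy_bound (h := h) (k := k)).
have H := spline_risk_le (lam := lambda_rate al be q) q hp m10 m20 (N n)
  (xO n) n0 xd lam0 K0 Kb admf.
apply: le_trans H _.
rewrite lee_fin -/I0 lamE.
have I00 : 0 <= I0 by exact: ip_ge0.
have -> : C / h * (32 * (sigma ^+ 2 * (C / h / n%:R))
    + 64 * (C / h * ((q n)%:R / n%:R)) * ((m1 + m2) ^+ 2 + sigma ^+ 2) + 8 * h ^+ 4 * I0) =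
  32 * sigma ^+ 2 * C ^+ 2 * (n%:R^-1 / h ^+ 2) +
  64 * C ^+ 2 * ((m1 + m2) ^+ 2 + sigma ^+ 2) *
    ((q n)%:R / n%:R / h ^+ 2) + 8 * C * I0 * h ^+ 3.
  by field; rewrite !gt_eqF.
have c1 : 0 <= 32 * sigma ^+ 2 * C ^+ 2
  by exact: mulr_ge0 (mulr_ge0 (ler0n _ _) (sqr_ge0 _)) (sqr_ge0 _).
have c2 : 0 <= 64 * C ^+ 2 * ((m1 + m2) ^+ 2 + sigma ^+ 2).
  exact: mulr_ge0 (mulr_ge0 (ler0n _ _) (sqr_ge0 _)) (addr_ge0 (sqr_ge0 _) (sqr_ge0 _)).
have c3 : 0 <= 8 * C * I0 by rewrite !mulr_ge0// ?ltW.
rewrite /b; apply: lerD; first apply: lerD; rewrite ler_wpM2l//.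
apply: le_trans h3; rewrite -[leRHS]mulr1 exprS ler_wpM2l ?(ltW h0)//.
by rewrite exprn_ile1// ltW.
Qed.

End SplineConsistency.

(** * Lower bound *)

Section LowerBound.
Context (R : realType) (d : measure_display) (T : measurableType d).
Variable P : probability T R.
Notation mu := (@lebesgue_measure R).
Notation Om := (Omega R).

(* [ip v v = 0] makes [v] a derivative of the zero function, so that
   [W2_derivs0_deriv] applies one order lower. *)
Lemma ip_self_eq0 (v v1 : R -> R) : has_L2_deriv v v1 -> ip v v = 0 ->
  forall t, Om t -> v t = 0.
Proof.
move=> vv1 v0.
have sv : square_integrable v by apply/continuous_sqint/sqint_deriv_continuous/vv1.
have v00 : has_L2_deriv (fun=> 0) v.
  split=> // x Ox; rewrite add0r Rintegral_indic_ip; last first.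
    by move: Ox; rewrite OmegaE => /andP[_ ?]; exact: itv_sub_Omega.
  by rewrite ipC (sqint_ip0 sv _ v0)//; exact: sqint_indic.
apply: (@W2_derivs0_deriv _ (fun=> 0) v v1) => //; split=> //.
exact: (sqint_cst (0 : R)).
Qed.

Lemma bump_exists (m b : R) : 0 < m -> 0 < b -> b < 1 -> exists f : R -> R,
  [/\ admissible m f, forall t, Om t -> b <= t -> f t = 0 & 0 < ip f f].
Proof.
(* [u] is the double primitive of the indicator of [0, b] that vanishes to first
   order at 1, hence on [b, 1]. *)
move=> m0 b0 b1; pose h : R -> R := \1_(`[0, b]).
have sub : `[0, b] `<=` Om by apply: itv_sub_Omega => //; exact: ltW.
have sh : square_integrable h by exact: sqint_indic.
pose be := - \int[mu]_(t in `[0, 1]) h t.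
pose u1 s := be + \int[mu]_(t in `[0, s]) h t.
pose al := - \int[mu]_(t in `[0, 1]) u1 t.
pose u x := al + \int[mu]_(s in `[0, x]) u1 s.
have W : W2_derivs u u1 h by exact: W2_derivs_primitive.
have [su u01 u12] := W.
have O1 : Om 1 by rewrite OmegaE ler01 lexx.
have u1_0 s : Om s -> b <= s -> u1 s = 0.
  rewrite OmegaE => /andP[s0 s1] bs; apply/eqP; rewrite -oppr_eq0; apply/eqP.
  have -> : - u1 s = u1 1 - u1 s by rewrite {2}/u1 /be addNr sub0r.
  rewrite (deriv_increment u12)// Rintegral_indic_ip; last exact: itv_sub_Omega.
  rewrite /ip /Rintegral integral0_eq// => t _; rewrite /h !indicE !mem_setE !in_itv/=.
  case: (ltP s t) => st; rewrite ?mul0r//= (leNgt t b) (le_lt_trans bs st) andbF mulr0//.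
have u_0 s : Om s -> b <= s -> u s = 0.
  rewrite OmegaE => /andP[s0 s1] bs; apply/eqP; rewrite -oppr_eq0; apply/eqP.
  have -> : - u s = u 1 - u s by rewrite {2}/u /al addNr sub0r.
  rewrite (deriv_increment u01)// /Rintegral integral0_eq// => t;
    rewrite /= in_itv/= => /andP[st t1].
  by rewrite u1_0// ?OmegaE ?t1 ?(le_trans s0 (ltW st))// (le_trans bs (ltW st)).
(* If [u] vanished, so would [u1] and the squared norm of [h], which is b > 0. *)
have u_neq0 : 0 < ip u u.
  rewrite lt_def ip_ge0 andbT; apply/negP => /eqP uu0.
  have uz := ip_self_eq0 u01 uu0.
  have u1z := W2_derivs0_deriv W uz.
  have : ip h h = 0.
    apply: Rintegral_itv0_eq0 => // x Ox; have := u12.2 x Ox.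
    by rewrite !u1z ?OmegaE ?lexx ?ler01// add0r => <-.
  rewrite ip_indic// lebesgue_measure_itv/= lte_fin b0 /= subr0 => bz.
  by move: b0; rewrite bz ltxx.
pose M := L2norm u1; have M0 : 0 <= M by exact: L2norm_ge0.
have uM t : Om t -> `|u t| <= M.
  move=> Ot; have := deriv_holder u01 O1 Ot;
    rewrite (u_0 1)// ?(ltW b1)// subr0 => /le_trans; apply.
  rewrite -[leRHS]mul1r ler_wpM2r// -[leRHS]sqrtr1 ler_wsqrtr//.
  by move: Ot; rewrite OmegaE => /andP[? ?]; rewrite ler_norml; apply/andP; split; lra.
(* Scaling brings the sup bound [M] of [u] below [m]; M + 1 avoids dividing by zero. *)
pose c := m / (M + 1); have c0 : 0 < c by rewrite divr_gt0//; lra.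
exists (fun t => c * u t); split.
- split.
    exists (fun t => c * u1 t), (fun t => c * h t).
    have := W2_derivs_comb c 0 W W.
    by congr W2_derivs; apply/funext => t; rewrite mul0r addr0.
  move=> t Ot; rewrite normrM (gtr0_norm c0) /c mulrAC ler_pdivrMr; last lra.
  by rewrite ler_pM2l//; have := uM t Ot; lra.
- by move=> t Ot bt; rewrite u_0// mulr0.
- rewrite ipZl//; last exact: sqintZ.
  by rewrite ipC ipZl//; exact: mulr_gt0 c0 (mulr_gt0 c0 u_neq0).
Qed.

(** No answer [g] is close to both functions: f1 - f0 = (f1 - g) - (f0 - g), and (a - b)^2 <= 2 a^2
    + 2 b^2. *)
Lemma sq_loss_two_points f0 f1 g : square_integrable f1 -> (forall t, f0 t = 0) ->
  measurable_fun Om g ->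
  ((ip f1 f1)%:E <= 2%:E * (sq_loss 2%:E f1 g + sq_loss 2%:E f0 g))%E.
Proof.
move=> sf f00 mg.
have mO := @measurable_Omega R.
have mf0 : measurable_fun Om f0.
  by rewrite (_ : f0 = cst 0)//; apply/funext => t; rewrite f00.
have [mf _] := sf.
have m1 : measurable_fun Om (fun t => ((f1 t - g t) ^+ 2)%:E).
  by apply/measurable_EFinP; apply: measurable_funX; exact: measurable_funB.
have m0 : measurable_fun Om (fun t => ((f0 t - g t) ^+ 2)%:E).
  by apply/measurable_EFinP; apply: measurable_funX; exact: measurable_funB.
rewrite !sq_loss2E -ge0_integralD//; last 2 first.
- by move=> t _; rewrite lee_fin sqr_ge0.
- by move=> t _; rewrite lee_fin sqr_ge0.
rewrite -ge0_integralZl//; last 2 first.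
- exact: emeasurable_funD.
- by move=> t _; rewrite adde_ge0// lee_fin sqr_ge0.
have -> : (ip f1 f1)%:E = (\int[mu]_(t in Om) (f1 t * f1 t)%:E)%E.
  by rewrite /ip /Rintegral fineK//; apply: integrable_fin_num => //; exact: sqintM.
apply: ge0_le_integral => //.
- by move=> t _; rewrite lee_fin -expr2 sqr_ge0.
- by apply/measurable_EFinP; exact: measurable_funM.
- by apply: measurable_funeM; exact: emeasurable_funD.
- move=> t _; rewrite -EFinD -EFinM lee_fin f00.
  have := sqr_ge0 (f1 t - g t + (0 - g t)); lra.
Qed.

(** Upper expectations need not be additive, but measurable majorants of [h0] and [h1] with
    integrals below c / 2 would have a sum dominating the constant [c], whose integral is [c]. *)
Lemma upper_expectation_add (h0 h1 : T -> \bar R) (c : R) :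
  (forall w, 0 <= h0 w)%E -> (forall w, 0 <= h1 w)%E ->
  (forall w, c%:E <= h0 w + h1 w)%E ->
  (upper_expectation P h0 < (c / 2)%:E)%E -> (upper_expectation P h1 < (c / 2)%:E)%E -> False.
Proof.
move=> h00 h10 ch.
move=> /ereal_inf_lt[_ [g0 [mg0 hg0] <-] l0] /ereal_inf_lt[_ [g1 [mg1 hg1] <-] l1].
have g00 w : (0 <= g0 w)%E by exact: le_trans (hg0 w).
have g10 w : (0 <= g1 w)%E by exact: le_trans (hg1 w).
have : (c%:E <= \int[P]_w g0 w + \int[P]_w g1 w)%E.
  rewrite -ge0_integralD//.
  have cP : (\int[P]_w c%:E = c%:E)%E.
    transitivity (c%:E * P setT)%E; last by rewrite probability_setT mule1.
    exact: integral_cst.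
  have [c0|c0] := leP 0 c; last first.
    by apply: le_trans (_ : 0 <= _)%E; [rewrite lee_fin ltW|apply: integral_ge0 => w _;
      exact: adde_ge0].
  rewrite -cP; apply: ge0_le_integral => //.
  - exact: emeasurable_funD.
  - by move=> w _; apply: le_trans (ch w) _; apply: leeD.
rewrite leNgt => /negP; apply; apply: lt_le_trans (lteD l0 l1) _.
by rewrite -EFinD lee_fin; lra.
Qed.

Lemma upper_expectation_le (h h' : T -> \bar R) : (forall w, h w <= h' w)%E ->
  (upper_expectation P h <= upper_expectation P h')%E.
Proof.
move=> hh; apply: le_ereal_inf => _ [g [mg hg] <-]; exists g => //; split=> // w.
exact: le_trans (hh w) (hg w).
Qed.

Lemma risk_2y (eps : forall n, 'I_n -> {RV P >-> R}) x m2 q f (est : estimator R) n :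
  measurable_fun Om f -> measurable_estimator est ->
  (risk 2%:E eps x m2 q f est n <= risk +oo%E eps x m2 q f est n)%E.
Proof.
move=> mf mest; apply: upper_expectation_le => w; apply: ge_ereal_sup => _ [S hS <-].
apply: le_trans (sq_loss_2y mf (mest _ _ _)) _.
by apply: ereal_sup_ubound; exists S.
Qed.

(** Half of [c] is spent on F b, the other half on the distance between the empirical distribution
    function and F at [b]. *)
Lemma few_design_points (x : forall n, 'I_n -> R) (c : R) : 0 < c ->
  regular_design x -> exists b : R, [/\ 0 < b, b < 1 &
    \forall n \near \oo, #|[set i | x n i <= b]%SET|%:R <= c * n%:R].
Proof.
move=> c0 [F [p [pmin [unif [F0 F1] [cF _] _ _]]]].
have O0 : Om 0 by rewrite OmegaE lexx ler01.
have [b [b0 b1 Fb]] : exists b : R, [/\ 0 < b, b < 1 & F b < c / 2].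
  have [_ Fr _] := (continuous_within_itvP F ltr01).1 cF.
  have e0 : 0 < c / 2 by rewrite divr_gt0.
  move/cvgrPdist_lt : Fr => /(_ _ e0); rewrite F0 => Fr.
  near (0 : R)^'+ => b; exists b; split=> //.
  by have : `|0 - F b| < c / 2 by [near: b]; rewrite sub0r normrN; apply: le_lt_trans;
    exact: ler_norm.
exists b; split=> //.
have Ob : Om b by rewrite OmegaE !ltW.
have cb : empirical_cdf (x n) b @[n --> \oo] --> F b.
  have sub : [set b] `<=` Om by move=> _ ->.
  by have := uniform_subset_cvg _ sub unif; rewrite uniform_set1; apply; exact: fmap_filter.
have e0 : 0 < c / 2 by rewrite divr_gt0.
move/cvgrPdist_lt : cb => /(_ _ e0); apply: filterS2 (nbhs_infty_gt 0) => n n0.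
have nR : 0 < n%:R :> R by rewrite ltr0n.
have -> : #|[set i | x n i <= b]%SET|%:R = n%:R * empirical_cdf (x n) b.
  rewrite /empirical_cdf mulVKf ?gt_eqF// -sum1_card natr_sum big_mkcond/=.
  by apply: eq_bigr => i _; rewrite inE; case: (x n i <= b).
rewrite distrC ltr_norml => /andP[_ H]; rewrite mulrC ler_pM2r//; lra.
Unshelve. all: by end_near.
Qed.

Lemma frequent_corruption_lower_bound (eps : forall n, 'I_n -> {RV P >-> R})
    (x : forall n, 'I_n -> R) (m1 m2 c : R) (q : nat -> nat) (est : estimator R) :
  0 < m1 -> 0 <= m2 -> 0 < c -> (forall n i, Om (x n i)) -> regular_design x ->
  (forall N, exists2 n, (N <= n)%N & c * n%:R <= (q n)%:R) ->
  measurable_estimator est ->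
  exists f : R -> R,
        [/\ admissible m1 f,
            ~ (risk 2%:E eps x m2 q f est n @[n --> \oo] --> 0%E)
          & ~ (risk +oo%E eps x m2 q f est n @[n --> \oo] --> 0%E)].
Proof.
move=> m10 m20 c0 xO xreg freq mest.
have [b [b0 b1 few]] := few_design_points c0 xreg.
have [f1 [adm1 f1b f1pos]] := bump_exists m10 b0 b1.
pose f0 : R -> R := fun=> 0.
have adm0 : admissible m1 f0.
  by split; [exact: W2_cst0|move=> t _; rewrite normr0 ltW].
(* The sup-norm risk dominates the L2 risk, so its convergence to zero would force that of the L2
   risk. *)
suff [f admf H] : exists2 f, admissible m1 f &
    ~ (risk 2%:E eps x m2 q f est n @[n --> \oo] --> 0%E).
  exists f; split; [exact: admf|exact: H|move=> H'; apply: H].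
  apply: (@squeeze_cvge _ \oo _ _ (fun=> 0%E) (fun n => risk 2%:E eps x m2 q f est n)
    (fun n => risk +oo%E eps x m2 q f est n)) H'; last exact: cvg_cst.
  apply: nearW => n; rewrite risk_ge0/=; apply: risk_2y => //.
  exact: W2_measurable admf.1.
apply: contrapT => nH.
have H f : admissible m1 f -> risk 2%:E eps x m2 q f est n @[n --> \oo] --> 0%E.
  by move=> admf; apply: contrapT => h; apply: nH; exists f.
pose e := ip f1 f1 / 2.
have e0 : 0 < e by rewrite divr_gt0.
have e20 : (0 < (e / 2)%:E)%E by rewrite lte_fin divr_gt0.
have near_lt f : admissible m1 f ->
  \forall n \near \oo, (risk 2%:E eps x m2 q f est n < (e / 2)%:E)%E.
  move=> /H rc; apply: (rc [set y | (y < (e / 2)%:E)%E]).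
  by apply: open_nbhs_nbhs; split; [exact: open_ereal_lt_ereal|exact: e20].
(* Eventually both risks are small and few points lie in [0, b]; [freq] then supplies such an [n] at
   which the budget covers those points. *)
have [N _ HN] : \forall n \near \oo, [/\ #|[set i | x n i <= b]%SET|%:R <= c * n%:R,
   (risk 2%:E eps x m2 q f0 est n < (e / 2)%:E)%E & (risk 2%:E eps x m2 q f1 est n <
     (e / 2)%:E)%E].
  by apply: filterS3 few (near_lt _ adm0) (near_lt _ adm1) => n.
have [n Nn cq] := freq N.
have [cardb r0 r1] := HN n Nn.
apply: upper_expectation_add r0 r1.
- by move=> w; exact: worst_loss_ge0.
- by move=> w; exact: worst_loss_ge0.
move=> w.
(* Reporting 0 on [0, b] makes the data of [f0] and [f1] coincide. *)
pose S : {set 'I_n} * ('I_n -> R) := ([set i | x n i <= b]%SET, fun=> 0).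
have hS : strategies (q n) m2 S.
  by split=> [|i _]; rewrite ?normr0// -(ler_nat R) (le_trans cardb).
pose ew i := eps n i w.
have obsE : observed f1 (x n) ew S = observed f0 (x n) ew S.
  apply/funext => i; rewrite /observed inE; case: leP => // bx.
  by rewrite f1b// ltW.
have up f : (sq_loss 2%:E f (est n (x n) (observed f (x n) ew S)) <=
    worst_loss 2%:E (q n) m2 f est (x n) ew)%E.
  by apply: ereal_sup_ubound; exists S.
apply: le_trans (leeD (up f0) (up f1)).
rewrite -obsE; set g := est _ _ _.
have mg : measurable_fun Om g by exact: mest.
have sf1 : square_integrable f1 by case: adm1 => [[? [? []]]].
have := sq_loss_two_points sf1 (fun t => erefl : f0 t = 0) mg.
rewrite muleC -lee_pdivrMr// => /le_trans; apply.
by rewrite addeC.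
Qed.
End LowerBound.

Lemma Theta_lower (R : realType) (q : nat -> nat) :
  (fun n : nat => (q n)%:R : R^o) =Theta_\oo (fun n : nat => n%:R : R^o) ->
  exists2 c : R, 0 < c & forall N, exists2 n, (N <= n)%N & c * n%:R <= (q n)%:R.
Proof.
rewrite eqThetaE qualifE => /asboolP[[k1 k2] /= /andP[k10 _] [M _ H]].
exists k1 => // N; exists (maxn N M); first exact: leq_maxl.
by have [+ _] := H (maxn N M) (leq_maxr _ _); rewrite !normr_nat.
Qed.

Lemma not_littleo_freq (R : realType) (q : nat -> nat) :
  ~ ((fun n : nat => (q n)%:R : R^o) =o_\oo (fun n : nat => n%:R : R^o)) ->
  exists2 c : R, 0 < c & forall N, exists2 n, (N <= n)%N & c * n%:R <= (q n)%:R.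
Proof.
move=> nqo; apply: contrapT => H; apply: nqo; apply/eqoP => e e0.
apply: contrapT => H'; apply: H; exists e => // N; apply: contrapT => H2; apply: H'.
exists N => // n /= Nn; rewrite !normr_nat leNgt; apply/negP => lt.
by apply: H2; exists n => //; exact: ltW.
Qed.

Unset Implicit Arguments.
Set Strict Implicit.

Theorem corollary4 (R : realType) (d : measure_display) (T : measurableType d)
    (P : probability T R) (eps : forall n : nat, 'I_n -> {RV P >-> R})
    (x : forall n : nat, 'I_n -> R) (m1 m2 sigma : R)
    (m1_gt0 : 0 < m1) (m2_ge0 : 0 <= m2)
    (noise : forall n : nat, iid_noise sigma (eps n))
    (x_Omega : forall (n : nat) (i : 'I_n), Omega R (x n i))
    (x_regular : regular_design x)
    (x_quasi_uniform : quasi_uniform_design x) :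
  [/\
    (* (a) *)
    forall (q : nat -> nat) (f : R -> R),
      corruption_budget q ->
      (fun n : nat => (q n)%:R : R^o) =o_\oo (fun n : nat => n%:R : R^o) ->
      admissible m1 f ->
      risk 2%:E eps x m2 q f (spline_estimator (lambda_L2 R q)) n
        @[n --> \oo] --> 0%E
      /\
      risk +oo%E eps x m2 q f (spline_estimator (lambda_Linf R q)) n
        @[n --> \oo] --> 0%E,
    (* (b) *)
    forall q : nat -> nat,
      corruption_budget q ->
      (fun n : nat => (q n)%:R : R^o) =Theta_\oo (fun n : nat => n%:R : R^o) ->
      forall est : estimator R, measurable_estimator est ->
      exists f : R -> R,
        [/\ admissible m1 f,
            ~ (risk 2%:E eps x m2 q f est n @[n --> \oo] --> 0%E)
          & ~ (risk +oo%E eps x m2 q f est n @[n --> \oo] --> 0%E)]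
  & (* (c) *)
    optimal_tolerance 2%:E eps x m1 m2
      (fun q => spline_estimator (lambda_L2 R q))
    /\
    optimal_tolerance +oo%E eps x m1 m2
      (fun q => spline_estimator (lambda_Linf R q))].
Proof.
have m10 := ltW m1_gt0.
have tol p al be (q : nat -> nat) f : p = 2%:E \/ p = +oo%E ->
    0 <= al -> al < 3 / 5 -> 0 < be -> be < 2 -> corruption_budget q ->
    (fun n : nat => (q n)%:R : R^o) =o_\oo (fun n : nat => n%:R : R^o) ->
    admissible m1 f ->
    risk p eps x m2 q f (spline_estimator (lambda_rate al be q)) n @[n --> \oo] --> 0%E.
  move=> hp al0 al1 be0 be1 qb qo admf.
  exact: (spline_risk_cvg hp m10 m2_ge0 noise x_Omega x_quasi_uniform qb qo al0 al1 be0
    be1 admf).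
have optimal p al be : p = 2%:E \/ p = +oo%E ->
    0 <= al -> al < 3 / 5 -> 0 < be -> be < 2 ->
    optimal_tolerance p eps x m1 m2 (fun q => spline_estimator (lambda_rate al be q)).
  move=> hp al0 al1 be0 be1 q qb [est [mest cest]]; split; first exact: spline_measurable.
  move=> f admf; apply: tol => //; apply: contrapT => /not_littleo_freq[c c0 freq].
  have [g [admg n2 ny]] := frequent_corruption_lower_bound eps m1_gt0 m2_ge0 c0 x_Omega
    x_regular freq mest.
  by have := cest g admg; case: hp => ->; [exact: n2|exact: ny].
have L2E (q : nat -> nat) : lambda_L2 R q = lambda_rate (2 / 5) (4 / 3) q by [].
have LyE (q : nat -> nat) : lambda_Linf R q = lambda_rate (1 / 2) (6 / 5) q by [].
split.
- move=> q f qb qo admf; rewrite L2E LyE; split.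
    by apply: tol qb qo admf; [left|lra..].
  by apply: tol qb qo admf; [right|lra..].
- move=> q qb qn est mest; have [c c0 freq] := Theta_lower qn.
  exact: (frequent_corruption_lower_bound eps m1_gt0 m2_ge0 c0 x_Omega x_regular freq mest).
- split.
    rewrite (_ : (fun q => _) = (fun q => spline_estimator (lambda_rate (2 / 5) (4 / 3) q)))//.
    by apply: optimal; [left|lra..].
  rewrite (_ : (fun q => _) = (fun q => spline_estimator (lambda_rate (1 / 2) (6 / 5) q)))//.
  by apply: optimal; [right|lra..].
Qed.
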